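(* Let $\alpha\in\mathbb R$ and let $V_\alpha:L^2(\mu)\to L^2(\mu_\alpha)$ be the unitary operator described in the context. Then for every compactly supported $C^1$ function $f$ on $\mathbb R$, $$V_\alpha f(s)=f(s)-\alpha\int_{\mathbb R}\frac{f(s)-f(t)}{s-t}\,d\mu(t)\qquad(\mu_\alpha\text{-a.e. } s),$$ where the integrand at $t=s$ is interpreted as $f'(s)$.
   Context: Let $\mu$ be a nonzero positive Borel measure on $\mathbb R$ with $\int_{\mathbb R}(1+|t|)^{-1}\,d\mu(t)<\infty$, and let $M_t$ denote multiplication by the independent variable $t$ on $L^2(\mu)$. For $\alpha\in\mathbb R$, $A_\alpha$ denotes the (possibly singular, form-bounded) rank one perturbation ''$A_\alpha=M_t+\alpha(\,\cdot\,,\mathbf 1)\mathbf 1$'', rigorously defined as the self-adjoint operator on $L^2(\mu)$ whose resolvent is, for $\lambda\in\mathbb C\setminus\mathbb R$, $$(A_\alpha-\lambda I)^{-1}f=(M_t-\lambda I)^{-1}f-\frac{\alpha\int\frac{f(t)\,d\mu(t)}{t-\lambda}}{1+\alpha F(\lambda)}\,(M_t-\lambda I)^{-1}\mathbf 1,\qquad F(\lambda)=\int_{\mathbb R}\frac{d\mu(t)}{t-\lambda},$$ and also $(A_\alpha-\lambda I)^{-1}\mathbf 1:=\frac{1}{1+\alpha F(\lambda)}(M_t-\lambda I)^{-1}\mathbf 1$. Let $\mu_\alpha$ be the spectral measure of $A_\alpha$ with respect to $\mathbf 1$, i.e. the unique positive Borel measure with $\frac{F(\lambda)}{1+\alpha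 F(\lambda)}=\int_{\mathbb R}\frac{d\mu_\alpha(s)}{s-\lambda}$ for $\lambda\notin\mathbb R$, and let $M_s$ be multiplication by the independent variable $s$ on $L^2(\mu_\alpha)$. $V_\alpha:L^2(\mu)\to L^2(\mu_\alpha)$ is the unitary operator realizing the spectral representation of $A_\alpha$ with $\mathbf 1\mapsto\mathbf 1$, i.e. $V_\alpha(A_\alpha-\lambda I)^{-1}=(M_s-\lambda I)^{-1}V_\alpha$ and $V_\alpha(A_\alpha-\lambda I)^{-1}\mathbf 1=(M_s-\lambda I)^{-1}\mathbf 1$ for all $\lambda\in\mathbb C\setminus\mathbb R$. *)

(* Defs.v *)
From HB Require Import structures.
From mathcomp Require Import all_boot all_algebra.
From mathcomp Require Import all_classical all_reals all_analysis.
From mathcomp Require Export complex.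
Import GRing.Theory Num.Theory numFieldNormedType.Exports.

Set Implicit Arguments.
Unset Strict Implicit.
Unset Printing Implicit Defensive.

Local Open Scope classical_set_scope.
Local Open Scope ring_scope.
Local Open Scope complex_scope.

Section Defs.
Variable R : realType.
Notation C := (R[i]).
Local Notation Re := (@complex.Re R).
Local Notation Im := (@complex.Im R).

Definition Cint (mu : {measure set R -> \bar R}) (f : R -> C) : C :=
  Complex (Rintegral mu setT (fun t => Re (f t)))
          (Rintegral mu setT (fun t => Im (f t))).

Definition Cintegrable (mu : {measure set R -> \bar R}) (f : R -> C) : Prop :=
  mu.-integrable setT (fun t => (Re (f t))%:E) /\
  mu.-integrable setT (fun t => (Im (f t))%:E).

Definition Csqnorm (z : C) : R := Re z ^+ 2 + Im z ^+ 2.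

Definition L2 (mu : {measure set R -> \bar R}) (f : R -> C) : Prop :=
  [/\ measurable_fun setT (fun t => Re (f t)),
      measurable_fun setT (fun t => Im (f t)) &
      mu.-integrable setT (fun t => (Csqnorm (f t))%:E)].

Definition ae_eqC (mu : {measure set R -> \bar R}) (f g : R -> C) : Prop :=
  {ae mu, forall t, f t = g t}.

Definition nonreal (l : C) : Prop := Im l != 0.

Definition cauchyT (mu : {measure set R -> \bar R}) (l : C) : C :=
  Cint mu (fun t => (t%:C - l)^-1).

(* (A_alpha - lambda I)^{-1} f, by the formula of the context *)
Definition resolvent (mu : {measure set R -> \bar R}) (a : R) (l : C)
    (f : R -> C) : R -> C :=
  fun t => (t%:C - l)^-1 * f t
    - (a%:C * Cint mu (fun u => f u * (u%:C - l)^-1)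
       / (1 + a%:C * cauchyT mu l)) * (t%:C - l)^-1.

(* (A_alpha - lambda I)^{-1} 1 := (1 + alpha F(lambda))^{-1} (M_t - lambda)^{-1} 1 *)
Definition resolvent1 (mu : {measure set R -> \bar R}) (a : R) (l : C) :
    R -> C :=
  fun t => (1 + a%:C * cauchyT mu l)^-1 * (t%:C - l)^-1.

(* mua is the spectral measure mu_alpha of A_alpha w.r.t. 1:
   F/(1+alpha F) = int dmua(s)/(s - lambda) for nonreal lambda *)
Definition is_pert_spectral_measure (mu : {measure set R -> \bar R}) (a : R)
    (mua : {measure set R -> \bar R}) : Prop :=
  forall l : C, nonreal l ->
    Cintegrable mua (fun s => (s%:C - l)^-1) /\
    cauchyT mu l / (1 + a%:C * cauchyT mu l) = cauchyT mua l.

(* V : L^2(mu) -> L^2(mua) is the unitary operator realizing the spectral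
   representation of A_alpha with 1 |-> 1 (acting on representatives). *)
Record spectral_rep (mu : {measure set R -> \bar R}) (a : R)
    (mua : {measure set R -> \bar R}) (V : (R -> C) -> (R -> C)) : Prop := {
  srep_wd : forall f g, L2 mu f -> L2 mu g -> ae_eqC mu f g ->
    ae_eqC mua (V f) (V g);
  srep_L2 : forall f, L2 mu f -> L2 mua (V f);
  srep_lin : forall (c : C) f g, L2 mu f -> L2 mu g ->
    ae_eqC mua (V (fun t => c * f t + g t)) (fun s => c * V f s + V g s);
  srep_iso : forall f, L2 mu f ->
    Rintegral mua setT (fun s => Csqnorm (V f s)) =
    Rintegral mu setT (fun t => Csqnorm (f t));
  srep_onto : forall h, L2 mua h -> exists f, L2 mu f /\ ae_eqC mua (V f) h;
  srep_res : forall (l : C) f, nonreal l -> L2 mu f ->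
    ae_eqC mua (V (resolvent mu a l f)) (fun s => (s%:C - l)^-1 * V f s);
  srep_res1 : forall l : C, nonreal l ->
    ae_eqC mua (V (resolvent1 mu a l)) (fun s => (s%:C - l)^-1)
}.

Definition C1R (g : R -> R) : Prop :=
  (forall x, derivable g x 1) /\ continuous (derive1 g).

Definition C1c (f : R -> C) : Prop :=
  [/\ C1R (fun t => Re (f t)), C1R (fun t => Im (f t)) &
      exists a b : R, forall t, (t < a \/ b < t)%R -> f t = 0].

Definition Cderiv (f : R -> C) (x : R) : C :=
  Complex (derive1 (fun t => Re (f t)) x) (derive1 (fun t => Im (f t)) x).

Definition diffquot (f : R -> C) (s t : R) : C :=
  if t == s then Cderiv f s else (f s - f t) / (s%:C - t%:C).

End Defs.

(* Main.v *)
(* Write T g (s) = g(s) - a \int (g(s) - g(t))/(s - t) dmu(t). For a nonreal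
   pole l and k = (t - l)^-1, both V and T satisfy
     k |-> (1 + a F(l)) k  and  k g |-> k (V g) + a (\int g k dmu) k,
   the former because V intertwines the resolvents, the latter by the product
   rule for difference quotients. With l = c + i and l = c - i this gives V = T
   on p(u) and (t - c) p(u), where u = 1/(1 + (t - c)^2) and p is a polynomial
   with p(0) = 0. The identity passes to limits of sequences that converge
   pointwise with their derivatives, uniformly bounded in the norm
   sup (1 + |t|)|g| + sup |g'|: dominated convergence handles T, and V is an
   isometry. Bernstein polynomials then give V = T on phi(u) and
   (t - c) phi(u) for phi of class C^1. Finally, if f is supported in [c + 1, N],
   let phi(u(t)) = f(t) and psi(u(t)) = f(t)/(t - c) for t > c; being even and
   odd about c, phi(u) and (t - c) psi(u) cancel on t < c, so
   f = (phi(u) + (t - c) psi(u))/2. *)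

Require Import Defs.
From HB Require Import structures.
From mathcomp Require Import all_boot all_order all_algebra.
From mathcomp Require Import all_classical all_reals all_analysis.
From mathcomp Require Import complex measurable_realfun ring lra.
Import Order.TTheory GRing.Theory Num.Theory numFieldNormedType.Exports.

Local Open Scope classical_set_scope.
Local Open Scope ring_scope.
Local Open Scope complex_scope.

Set Implicit Arguments.
Unset Strict Implicit.
Unset Printing Implicit Defensive.

Local Notation Re := (@complex.Re _).
Local Notation Im := (@complex.Im _).

(** * Bernstein polynomials *)

Section Bernstein.
Variable R : realType.
Implicit Types (h : nat -> R) (x : R).

(* The degree [n] Bernstein polynomial of the samples [h 0 .. h n], given by de
   Casteljau's recursion so that its moments follow by induction on [n]. *)
Fixpoint bern (n : nat) h : {poly R} :=
  if n is m.+1 then 'X * bern m (h \o succn) + (1 - 'X) * bern m h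
  else (h 0%N)%:P.

Lemma bernS n h x :
  (bern n.+1 h).[x] = x * (bern n (h \o succn)).[x] + (1 - x) * (bern n h).[x].
Proof. by rewrite /= !hornerE. Qed.

Lemma bernD n h1 h2 x :
  (bern n (fun k => h1 k + h2 k)).[x] = (bern n h1).[x] + (bern n h2).[x].
Proof.
elim: n h1 h2 => [|n IH] h1 h2; first by rewrite /= !hornerE.
by rewrite !bernS !IH; ring.
Qed.

Lemma bernZ n c h x : (bern n (fun k => c * h k)).[x] = c * (bern n h).[x].
Proof.
elim: n h => [|n IH] h; first by rewrite /= !hornerE.
by rewrite !bernS !IH; ring.
Qed.

Lemma bern_cst n c x : (bern n (fun=> c)).[x] = c.
Proof.
elim: n => [|n IH]; first by rewrite /= !hornerE.
by rewrite bernS IH; ring.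
Qed.

Lemma bern_ge0 n h x : 0 <= x <= 1 -> (forall k, 0 <= h k) ->
  0 <= (bern n h).[x].
Proof.
move=> /andP[x0 x1].
elim: n h => [|n IH] h h0; first by rewrite /= !hornerE.
by rewrite bernS addr_ge0// mulr_ge0// ?subr_ge0// IH// => k; exact: h0.
Qed.

Lemma bern_le n h1 h2 x : 0 <= x <= 1 -> (forall k, h1 k <= h2 k) ->
  (bern n h1).[x] <= (bern n h2).[x].
Proof.
move=> x01 h12; rewrite -subr_ge0.
have -> : (bern n h2).[x] - (bern n h1).[x] = (bern n (fun k => h2 k + -1 * h1 k)).[x].
  by rewrite bernD bernZ; ring.
by apply: bern_ge0 => // k; rewrite mulN1r subr_ge0.
Qed.

Lemma bern_norm_le n h1 h2 x : 0 <= x <= 1 -> (forall k, `|h1 k| <= h2 k) ->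
  `|(bern n h1).[x]| <= (bern n h2).[x].
Proof.
move=> x01 h12; rewrite ler_norml; apply/andP; split; last first.
  by apply: bern_le => // k; exact: le_trans (ler_norm _) (h12 k).
rewrite -mulN1r -bernZ; apply: bern_le => // k.
by rewrite mulN1r lerNl; apply: le_trans (h12 k); rewrite -normrN ler_norm.
Qed.

Lemma bern_id n x : (bern n (fun k => k%:R)).[x] = n%:R * x.
Proof.
elim: n => [|n IH]; first by rewrite /= !hornerE.
rewrite bernS IH.
have -> : (bern n ((fun k : nat => k%:R) \o succn)).[x] = n%:R * x + 1.
  transitivity (bern n (fun k => k%:R + 1)).[x]; last by rewrite bernD IH bern_cst.
  by congr (bern n _).[x]; apply/funext => k /=; rewrite -natr1.
by rewrite -natr1; ring.
Qed.

(** The second moment of the binomial law about [y]; at [y = n x] it is the variance [n x (1 - x)].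
    The centre is left free because the induction replaces [y] by [y - 1] when the samples are
    shifted. *)
Lemma bern_variance n (y x : R) :
  (bern n (fun k => (k%:R - y) ^+ 2)).[x] = (n%:R * x - y) ^+ 2 + n%:R * x * (1 - x).
Proof.
elim: n y => [|n IH] y; first by rewrite /= !hornerE; ring.
rewrite bernS IH.
have -> : (fun k : nat => (k%:R - y) ^+ 2) \o succn = (fun k => (k%:R - (y - 1)) ^+ 2).
  by apply/funext => k /=; rewrite -natr1; ring.
by rewrite IH -natr1; ring.
Qed.

Lemma deriv_bern n h :
  (bern n.+1 h)^`() = n.+1%:R * bern n (fun k => h k.+1 - h k).
Proof.
elim: n h => [|n IH] h.
  by rewrite /= !poly.derivE mul1r rmorphB /=; ring.
(* The difference of the two branches of the recursion is the polynomial of the forward differences.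
   Differentiating the weights ['X] and [1 - 'X] produces one such copy, and the induction
   hypothesis supplies the other [n.+1]. *)
have bernB m h1 : bern m (fun k => h1 k.+1 - h1 k) = bern m (h1 \o succn) - bern m h1.
  elim: m h1 => [|m IHm] h1 /=; first by rewrite rmorphB.
  by rewrite IHm (IHm (h1 \o succn)) /=; ring.
have derivXp (p q : {poly R}) :
    ('X * p + (1 - 'X) * q)^`() = p - q + ('X * p^`() + (1 - 'X) * q^`()).
  by rewrite !poly.derivE; ring.
rewrite [LHS]derivXp (IH h) (IH (h \o succn)). rewrite -(bernB n.+1 h).
rewrite -[n.+2]addn1 natrD /=; ring.
Qed.

(** Chebyshev's argument: samples within [d] of [x] contribute at most [e], the others are
    controlled by the variance. The degree [m] may be [n] or [n - 1], since differentiating lowers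
    the degree by one but keeps the grid of step [1/n]. *)
Lemma bern_near m n h (L M d e x : R) : 0 <= x <= 1 -> (0 < n)%N ->
  0 < d -> (m <= n <= m.+1)%N -> 0 <= e ->
  (forall k, `|h k - L| <= M) ->
  (forall k, `|k%:R / n%:R - x| < d -> `|h k - L| <= e) ->
  `|(bern m h).[x] - L| <= e + M / d ^+ 2 * (2 / n%:R).
Proof.
move=> x01 n0 d0 mn e0 hM he.
have n0' : 0 < n%:R :> R by rewrite ltr0n.
have -> : (bern m h).[x] - L = (bern m (fun k => h k + (- L))).[x].
  by rewrite bernD bern_cst.
have M0 : 0 <= M by apply: le_trans (hM 0%N).
(* A quadratic majorant valid at every sample: where [|k/n - x| >= d], the factor
   [(k/n - x)^2 / d^2] is at least 1. *)
pose g k : R := e + (M / d ^+ 2 / n%:R ^+ 2) * (k%:R - n%:R * x) ^+ 2.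
apply: (@le_trans _ _ (bern m g).[x]).
  apply: bern_norm_le => // k; rewrite /g.
  have [kd|kd] := ltP `|k%:R / n%:R - x| d.
    apply: (le_trans (he k kd)); rewrite lerDl mulr_ge0 ?sqr_ge0//.
    by rewrite !divr_ge0 ?exprn_ge0 ?(ltW d0)// ltW.
  apply: (le_trans (hM k)).
  apply: (@le_trans _ _ (M * (`|k%:R / n%:R - x| ^+ 2 / d ^+ 2))).
    rewrite ler_peMr// ler_pdivlMr ?exprn_gt0// mul1r.
    by rewrite lerXn2r// ?nnegrE ?(ltW d0).
  rewrite real_normK ?num_real//.
  apply: (@le_trans _ _ (M / d ^+ 2 / n%:R ^+ 2 * (k%:R - n%:R * x) ^+ 2)); last by rewrite lerDr.
  rewrite le_eqVlt; apply/orP; left; apply/eqP; field.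
  by rewrite !gt_eqF.
rewrite /g bernD bern_cst bernZ bern_variance lerD2l.
rewrite -!mulrA ler_wpM2l// ler_wpM2l ?invr_ge0 ?exprn_ge0 ?(ltW d0)//.
rewrite mulrC ler_pdivrMr ?exprn_gt0//.
have -> : 2 / n%:R * n%:R ^+ 2 = 2 * n%:R :> R by field; rewrite gt_eqF.
move/andP: mn => [mn nm].
have mn' : m%:R <= n%:R :> R by rewrite ler_nat.
have nm' : n%:R <= m%:R + 1 :> R by rewrite natr1 ler_nat.
have n1 : 1 <= n%:R :> R by rewrite ler1n.
have m0 : 0 <= m%:R :> R by [].
move: x01 => /andP[x0 x1].
(* As [0 <= n - m <= 1], the second moment about [n x] is [((n - m) x)^2 + m x (1 - x) <= 1 + n <= 2
   n]. *)
have dx0 : 0 <= (n%:R - m%:R) * x by rewrite mulr_ge0// subr_ge0.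
have dx1 : (n%:R - m%:R) * x <= 1.
  by rewrite mulr_ile1// ?subr_ge0// lerBlDr addrC.
have s1 : ((n%:R - m%:R) * x) ^+ 2 <= 1 by rewrite exprn_ile1.
have s2 : m%:R * (x * (1 - x)) <= n%:R * 1.
  by rewrite ler_pM// ?mulr_ge0// ?subr_ge0// mulr_ile1 ?subr_ge0// lerBlDr lerDl.
have -> : m%:R * x - n%:R * x = - ((n%:R - m%:R) * x) by ring.
rewrite sqrrN; lra.
Qed.

End Bernstein.

(** * Difference quotients of decaying functions *)

Section Decay.
Variable R : realType.
Implicit Types (f g : R -> R) (M : R).

(** The weight is the one in the hypothesis on [mu], so these functions and their squares are
    [mu]-integrable even when [mu] is infinite. *)
Definition decaying f : Prop :=
  measurable_fun setT f /\ exists M, forall t, `|f t| * (1 + `|t|) <= M.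

Lemma normS_gt0 (t : R) : 0 < 1 + `|t|.
Proof. by rewrite ltr_wpDr. Qed.

Lemma ler_normS (x t : R) : `|x| <= `|x| * (1 + `|t|).
Proof. by rewrite ler_peMr// lerDl. Qed.

Lemma decayingD f g : decaying f -> decaying g ->
  decaying (fun t => f t + g t).
Proof.
move=> [mf [M fM]] [mg [N gN]]; split; first exact: measurable_funD.
exists (M + N) => t; apply: le_trans (lerD (fM t) (gN t)).
by rewrite -mulrDl ler_wpM2r ?ler_normD// ltW// normS_gt0.
Qed.

Lemma decayingM f g : decaying f -> decaying g ->
  decaying (fun t => f t * g t).
Proof.
move=> [mf [M fM]] [mg [N gN]]; split; first exact: measurable_funM.
exists (M * N) => t; rewrite normrM -mulrA ler_pM// ?mulr_ge0// ?(ltW (normS_gt0 _))//.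
exact: le_trans (ler_normS _ _) (fM t).
Qed.

Lemma decayingZ c f : decaying f -> decaying (fun t => c * f t).
Proof.
move=> [mf [M fM]]; split; first exact: measurable_funM.
by exists (`|c| * M) => t; rewrite normrM -mulrA ler_wpM2l.
Qed.

Definition dq g (s t : R) : R :=
  if t == s then g^`()%classic s else (g s - g t) / (s - t).

(** One constant bounds both the weighted size and the derivative, so that a sequence sharing the
    same [M] is ready for dominated convergence, both for [g] and for [dq g s]. *)
Definition C1bounded M g : Prop := forall x,
  [/\ derivable g x 1, `|g x| * (1 + `|x|) <= M & `|g^`()%classic x| <= M].

Lemma C1bounded_continuous M g : C1bounded M g -> continuous g.
Proof.
by move=> gM x; apply: differentiable_continuous; apply/derivable1_diffP; case: (gM x).
Qed.

Lemma C1bounded_decaying M g : C1bounded M g -> decaying g.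
Proof.
move=> gM; split; last by exists M => t; case: (gM t).
by apply: continuous_measurable_fun; exact: C1bounded_continuous gM.
Qed.

Lemma mean_value_norm g (M : R) : (forall x, derivable g x 1) ->
  (forall x, `|g^`()%classic x| <= M) ->
  forall s t, `|g s - g t| <= M * `|s - t|.
Proof.
move=> dg gM s t.
wlog ts : s t / t <= s.
  move=> H; have [|/ltW] := leP t s; first exact: H.
  by move=> st; rewrite distrC (distrC s); exact: H.
have [|//|x _ ->] := @MVT_segment R g g^`()%classic t s ts.
  by move=> x _; rewrite derive1E; apply: derivableP.
  apply: continuous_subspaceT => x.
  by apply: differentiable_continuous; apply/derivable1_diffP.
by rewrite normrM ler_wpM2r.
Qed.

Lemma normr_dq M g s t : C1bounded M g -> `|dq g s t| <= M.
Proof.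
move=> gM; rewrite /dq; case: eqP => [_|/eqP ts]; first by case: (gM s).
rewrite normrM normfV ler_pdivrMr ?normr_gt0 ?subr_eq0 1?eq_sym//.
by apply: mean_value_norm => x; case: (gM x).
Qed.

(** Split [1 + |t| <= (1 + |s|) + |s - t|]: the first part meets the mean value bound [M] on the
    quotient, and the second cancels the denominator, leaving [|g s - g t| <= 2 M]. *)
Lemma dq_decay M g s t : C1bounded M g ->
  `|dq g s t| * (1 + `|t|) <= M * (3 + `|s|).
Proof.
move=> gM.
have gM' x : `|g x| <= M by apply: le_trans (ler_normS _ x) _; case: (gM x).
have h1 : `|dq g s t| * `|s - t| <= 2 * M.
  rewrite -normrM /dq; case: eqP => [->|/eqP ts].
    by rewrite subrr mulr0 normr0 mulr_ge0// (le_trans _ (gM' s)).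
  rewrite divfK ?subr_eq0 1?eq_sym//.
  by apply: le_trans (ler_normB _ _) _; rewrite mulr2n mulrDl mul1r lerD.
apply: (@le_trans _ _ (`|dq g s t| * (1 + `|s|) + `|dq g s t| * `|s - t|)).
  rewrite -mulrDr ler_wpM2l// -addrA lerD2l.
  have -> : t = s - (s - t) by rewrite subKr.
  by rewrite [X in _ <= _ + `|X|](_ : _ = s - t) ?ler_normB// opprB addrC subrK.
apply: (@le_trans _ _ (M * (1 + `|s|) + 2 * M)).
  by rewrite lerD// ler_wpM2r ?(ltW (normS_gt0 _))// normr_dq.
by rewrite le_eqVlt; apply/orP; left; apply/eqP; ring.
Qed.

Lemma measurable_dq M g s : C1bounded M g -> measurable_fun setT (dq g s).
Proof.
move=> gM; rewrite /dq.
apply: (@measurable_fun_if _ _ _ _ _ _ _ _ (fun t => t == s)) => //.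
- by apply: measurable_fun_eqr.
- rewrite setTI; apply: open_continuous_measurable_fun.
    rewrite (_ : _ @^-1` _ = ~` [set s]).
      by rewrite openC; exact: closed_eq.
    by apply/seteqP; split => t /=; [move=> /eqP|move=> /eqP /negbTE].
  move=> t; rewrite inE /= => /negbT ts.
  apply: cvgM; last (apply: cvgV; first by rewrite subr_eq0 eq_sym).
    by apply: cvgB; [exact: cvg_cst|exact: C1bounded_continuous gM t].
  by apply: cvgB; [exact: cvg_cst|exact: cvg_id].
Qed.

Lemma dq_decaying M g s : C1bounded M g -> decaying (dq g s).
Proof.
move=> gM; split; first exact: measurable_dq gM.
by exists (M * (3 + `|s|)) => t; exact: dq_decay.
Qed.

Lemma C1bounded_lincomb c M N f g : C1bounded M f -> C1bounded N g ->
  C1bounded (`|c| * M + N) (fun t => c * f t + g t).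
Proof.
move=> fM gN x; have [df f1 f2] := fM x; have [dg g1 g2] := gN x.
have -> : (fun t => c * f t + g t) = (c *: f) + g by apply/funext.
have dcf : derivable (c *: f) x 1 by exact: derivableZ.
split; first exact: derivableD.
  apply: (@le_trans _ _ ((`|c * f x| + `|g x|) * (1 + `|x|))).
    by rewrite ler_wpM2r ?ler_normD// ltW// normS_gt0.
  by rewrite mulrDl lerD// normrM -mulrA ler_wpM2l.
rewrite derive1E deriveD// deriveZ//= -!derive1E.
by apply: le_trans (ler_normD _ _) (lerD _ _) => //; rewrite normrM ler_wpM2l.
Qed.

Lemma dq_lincomb c f g s t : derivable f s 1 -> derivable g s 1 ->
  dq (fun t => c * f t + g t) s t = c * dq f s t + dq g s t.
Proof.
move=> df dg; rewrite /dq; case: ifP => _; last by ring.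
have -> : (fun t => c * f t + g t) = (c *: f) + g by apply/funext.
have dcf : derivable (c *: f) s 1 by exact: derivableZ.
by rewrite derive1E deriveD// deriveZ//= -!derive1E.
Qed.

Lemma C1boundedM M N f g : C1bounded M f -> C1bounded N g ->
  C1bounded (2 * (M * N)) (fun t => f t * g t).
Proof.
move=> fM gN x; have [df f1 f2] := fM x; have [dg g1 g2] := gN x.
have f0 := le_trans (ler_normS _ _) f1; have g0 := le_trans (ler_normS _ _) g1.
have M0 : 0 <= M by apply: le_trans f2.
have N0 : 0 <= N by apply: le_trans g2.
have -> : (fun t => f t * g t) = f * g by apply/funext.
split; first exact: derivableM.
  rewrite normrM -mulrA; apply: (@le_trans _ _ (M * N)).
    by rewrite ler_pM// mulr_ge0// ltW// normS_gt0.
  by rewrite ler_peMl ?mulr_ge0// ler1n.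
rewrite derive1E deriveM// -!derive1E.
apply: le_trans (ler_normD _ _) _; rewrite !normrZ mulr2n mulrDl mul1r lerD//.
  by rewrite ler_pM.
by rewrite (mulrC M) ler_pM.
Qed.

(** The Leibniz rule is used with [f] frozen at [s] and [g] at [t]: integrating in [t] then pulls
    [f s] out and leaves integrals of [g] against [dq f s]. *)
Lemma dqM f g s t : derivable f s 1 -> derivable g s 1 ->
  dq (fun t => f t * g t) s t = f s * dq g s t + dq f s t * g t.
Proof.
move=> df dg; rewrite /dq; case: eqP => [->|_]; last by ring.
have -> : (fun t => f t * g t) = f * g by apply/funext.
rewrite derive1E deriveM// -!derive1E; congr (_ + _); exact: mulrC.
Qed.

End Decay.

(** * Resolvent kernels *)

Section LorentzKernel.
Variables (R : realType) (c : R).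

(** [lor] and [clor] are the imaginary and real parts of the resolvent kernel [1/(t - (c + i))]. *)
Definition lor (t : R) : R := (1 + (t - c) ^+ 2)^-1.
Definition clor (t : R) : R := (t - c) * lor t.

Lemma lor_den_gt0 t : 0 < 1 + (t - c) ^+ 2.
Proof. by rewrite ltr_wpDr// sqr_ge0. Qed.

Lemma lor_gt0 t : 0 < lor t.
Proof. by rewrite invr_gt0 lor_den_gt0. Qed.

Lemma lorE t : (1 + (t - c) ^+ 2) * lor t = 1.
Proof. by rewrite mulfV// gt_eqF// lor_den_gt0. Qed.

Lemma lor_le1 t : lor t <= 1.
Proof. by rewrite invf_le1 ?lor_den_gt0// lerDl sqr_ge0. Qed.

Lemma lor_sqr_le1 t : (t - c) ^+ 2 * lor t <= 1.
Proof. by rewrite -(lorE t) ler_wpM2r ?lerDr// ltW// lor_gt0. Qed.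

Lemma lor_abs_le1 t : `|t - c| * lor t <= 1.
Proof.
rewrite -(lorE t) ler_wpM2r// ?(ltW (lor_gt0 _))//.
rewrite -real_normK ?num_real//; have := normr_ge0 (t - c).
by move: (`|t - c|) => x x0; nra.
Qed.

Lemma is_derive_lor (t : R) : is_derive t (1 : R) lor (- 2 * (t - c) * lor t ^+ 2).
Proof.
have h : 1 + (t - c) ^+ 2 != 0 by rewrite gt_eqF// lor_den_gt0.
apply: is_derive_eq; first by apply: is_deriveV.
transitivity (- (1 + (t - c) ^+ 2) ^- 2 * (2 * (t - c))).
  rewrite /=; congr (_ * _); rewrite -![_ *: _]/(_ * _); ring.
rewrite /lor; field.
exact: h.
Qed.

Lemma is_derive_clor (t : R) :
  is_derive t (1 : R) clor (lor t - 2 * (t - c) ^+ 2 * lor t ^+ 2).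
Proof.
have hl := is_derive_lor t.
have -> : clor = (fun t => t - c) * lor by apply/funext.
apply: is_derive_eq.
rewrite -![_ *: _]/(_ * _); ring.
Qed.

Lemma le_normS_shift t : 1 + `|t| <= 1 + `|t - c| + `|c|.
Proof. by rewrite -addrA lerD2l -{1}(subrK c t) ler_normD. Qed.

Lemma C1bounded_lor : C1bounded (3 + `|c|) lor.
Proof.
move=> t; have hl := is_derive_lor t.
have l0 := ltW (lor_gt0 t); have l1 := lor_le1 t; have la := lor_abs_le1 t.
have c0 := normr_ge0 c.
split; first by [].
  rewrite ger0_norm//; apply: (@le_trans _ _ (lor t * (1 + `|t - c| + `|c|))).
    by rewrite ler_wpM2l// le_normS_shift.
  rewrite !mulrDr mulr1 (mulrC _ `|t - c|).
  have : lor t * `|c| <= 1 * `|c| by rewrite ler_wpM2r.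
  by lra.
rewrite derive1E derive_val expr2 !normrM normrN.
rewrite (ger0_norm l0) normr_nat.
have : `|t - c| * lor t * lor t <= 1 * 1 by rewrite ler_pM// mulr_ge0.
by rewrite -!mulrA; lra.
Qed.

Lemma C1bounded_clor : C1bounded (3 + `|c|) clor.
Proof.
move=> t; have hl := is_derive_clor t.
have l0 := ltW (lor_gt0 t); have l1 := lor_le1 t; have la := lor_abs_le1 t.
have ls := lor_sqr_le1 t.
have c0 := normr_ge0 c.
split; first by [].
  rewrite /clor normrM (ger0_norm l0).
  apply: (@le_trans _ _ (`|t - c| * lor t * (1 + `|t - c| + `|c|))).
    by rewrite ler_wpM2l ?mulr_ge0// le_normS_shift.
  rewrite !mulrDr mulr1.
  have : `|t - c| * lor t * `|c| <= 1 * `|c| by rewrite ler_wpM2r.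
  rewrite (mulrAC _ (lor t) `|t - c|) -expr2 real_normK ?num_real//.
  by lra.
rewrite derive1E derive_val.
have ls0 : 0 <= (t - c) ^+ 2 * lor t by rewrite mulr_ge0// sqr_ge0.
have : (t - c) ^+ 2 * lor t * lor t <= 1 * 1 by rewrite ler_pM.
have : 0 <= (t - c) ^+ 2 * lor t * lor t by rewrite mulr_ge0.
have -> : 2 * (t - c) ^+ 2 * lor t ^+ 2 = 2 * ((t - c) ^+ 2 * lor t * lor t) by ring.
by move=> h1 h2; rewrite ler_norml; apply/andP; split; lra.
Qed.

(** For [k(t) = 1/(t - l)] the resolvent identity reads [(k(s) - k(t))/(s - t) = - k(s) k(t)]. With
    [k = clor + i lor], this formula is its imaginary part, and the next one for [clor] its real
    part. *)
Lemma dq_lor s t :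
  dq lor s t = - (clor s * lor t + lor s * clor t).
Proof.
rewrite /dq; case: eqP => [->|/eqP ts].
  have hl := is_derive_lor s.
  by rewrite derive1E derive_val /clor; ring.
have st : s - t != 0 by rewrite subr_eq0 eq_sym.
rewrite /clor /lor; field.
by rewrite st !gt_eqF ?lor_den_gt0.
Qed.

Lemma dq_clor s t :
  dq clor s t = lor s * lor t - clor s * clor t.
Proof.
rewrite /dq; case: eqP => [->|/eqP ts].
  have hl := is_derive_clor s.
  rewrite derive1E derive_val /clor.
  transitivity (lor s * ((1 + (s - c) ^+ 2) * lor s) - 2 * (s - c) ^+ 2 * lor s ^+ 2).
    by rewrite lorE mulr1.
  ring.
have st : s - t != 0 by rewrite subr_eq0 eq_sym.
rewrite /clor /lor; field.
by rewrite st !gt_eqF ?lor_den_gt0.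
Qed.

(** The sign [e] treats both poles [c + i] and [c - i] at once. *)
Lemma resolvent_kernelE (e t : R) : e ^+ 2 = 1 ->
  (t%:C - Complex c e)^-1 = Complex (clor t) (e * lor t).
Proof.
move=> e1.
have k1 : (t%:C - Complex c e) * Complex (clor t) (e * lor t) = 1.
  apply/eqP; rewrite eq_complex /= /clor; apply/andP; split; apply/eqP; last by ring.
  transitivity ((e ^+ 2 + (t - c) ^+ 2) * lor t); first by ring.
  by rewrite e1 lorE.
have h : t%:C - Complex c e != 0.
  by apply/eqP => h; move: k1; rewrite h mul0r => /eqP; rewrite eq_sym oner_eq0.
by rewrite -[LHS]mulr1 -k1 mulrA mulVf// mul1r.
Qed.

End LorentzKernel.

(** * Integration of decaying functions against [mu] *)

Section DecayingIntegral.
Variables (R : realType) (mu : {measure set R -> \bar R}).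
Hypothesis mu_fin : (\int[mu]_t ((1 + `|t|)^-1 : R)%:E < +oo)%E.
Implicit Types (f g : R -> R).

Lemma measurable_weight :
  measurable_fun setT (fun t : R => (1 + `|t|)^-1).
Proof.
apply: continuous_measurable_fun => t.
apply: cvgV; first by rewrite gt_eqF// normS_gt0.
by apply: cvgD; [exact: cvg_cst|exact: cvg_norm].
Qed.

Lemma integrable_weight M :
  mu.-integrable setT (fun t : R => (M * (1 + `|t|)^-1)%:E).
Proof.
have : mu.-integrable setT (fun t : R => ((1 + `|t|)^-1)%:E).
  apply/integrableP; split; first (apply/measurable_EFinP; exact: measurable_weight).
  rewrite (eq_integral (fun t : R => ((1 + `|t|)^-1)%:E)) => [|t _].
    exact: mu_fin.
  by rewrite abse_EFin ger0_norm// invr_ge0 ltW// normS_gt0.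
by move=> h; exact: (integrableZl measurableT M h).
Qed.

Lemma decaying_integrable f : decaying f -> mu.-integrable setT (EFin \o f).
Proof.
move=> [mf [M fM]].
apply: (le_integrable measurableT _ _ (integrable_weight M)).
  exact/measurable_EFinP.
move=> t _; rewrite lee_fin; apply: le_trans (ler_norm _).
by rewrite ler_pdivlMr ?normS_gt0.
Qed.

Lemma decaying_L2 (f : R -> R[i]) :
  decaying (fun t => Re (f t)) -> decaying (fun t => Im (f t)) -> L2 mu f.
Proof.
move=> df dg; split; [by case: df|by case: dg|].
have sq (h : R -> R) : decaying h -> decaying (fun t => h t ^+ 2).
  move=> dh; rewrite (_ : (fun _ => _) = fun t => h t * h t); first exact: decayingM.
  by apply/funext => t; rewrite expr2.
exact: (decaying_integrable (decayingD (sq _ df) (sq _ dg))).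
Qed.

Lemma Rintegral_dominated (h : nat -> R -> R) f M :
  (forall n, measurable_fun setT (h n)) ->
  (forall n t, `|h n t| * (1 + `|t|) <= M) ->
  (forall t, h n t @[n --> \oo] --> f t) ->
  Rintegral mu setT (h n) @[n --> \oo] --> Rintegral mu setT f.
Proof.
move=> mh hM hf.
have mf : measurable_fun setT f by apply: measurable_fun_cvg => // t _; exact: hf.
have [||||fi _ hcv] := @dominated_convergence _ _ _ mu setT measurableT
  (fun n => EFin \o h n) (EFin \o f) (fun t => (M * (1 + `|t|)^-1)%:E)
  _ _ _ (integrable_weight M) _.
- by move=> n; exact/measurable_EFinP.
- exact/measurable_EFinP.
- by apply: aeW => t _; apply: cvg_EFin; [exact: nearW|exact: hf].
- by apply: aeW => t n _; rewrite lee_fin ler_pdivlMr ?normS_gt0.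
apply: fine_cvg; rewrite fineK //.
exact: integrable_fin_num.
Qed.

End DecayingIntegral.

(** * The spectral representation on resolvent kernels *)

Section ComplexDecay.
Variables (R : realType) (mu : {measure set R -> \bar R}).
Hypothesis mu_fin : (\int[mu]_t ((1 + `|t|)^-1 : R)%:E < +oo)%E.

Definition Cdecaying (f : R -> R[i]) : Prop :=
  decaying (fun t => Re (f t)) /\ decaying (fun t => Im (f t)).

Lemma Cdecaying_L2 f : Cdecaying f -> L2 mu f.
Proof. by move=> [? ?]; exact: decaying_L2. Qed.

Lemma Cdecaying_lincomb (k : R[i]) f g : Cdecaying f -> Cdecaying g ->
  Cdecaying (fun t => k * f t + g t).
Proof.
move=> [f1 f2] [g1 g2]; split.
  rewrite (_ : (fun _ => _) = fun t =>
    (Re k * Re (f t) + (- Im k) * Im (f t)) + Re (g t)).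
    by apply: decayingD => //; apply: decayingD; exact: decayingZ.
  by apply/funext => t; move: k (f t) (g t) => [? ?] [? ?] [? ?] /=; rewrite mulNr.
rewrite (_ : (fun _ => _) = fun t =>
    (Re k * Im (f t) + Im k * Re (f t)) + Im (g t)).
  by apply: decayingD => //; apply: decayingD; exact: decayingZ.
by apply/funext => t; move: k (f t) (g t) => [? ?] [? ?] [? ?] /=.
Qed.

Lemma decaying0 : decaying (fun _ : R => 0 : R).
Proof. by split=> //; exists 0 => t; rewrite normr0 mul0r. Qed.

Lemma Cdecaying0 : Cdecaying (fun=> 0).
Proof. by split; exact: decaying0. Qed.

Lemma Cdecaying_real (g : R -> R) : decaying g -> Cdecaying (fun t => (g t)%:C).
Proof. by split => //; exact: decaying0. Qed.

Lemma Cdecaying_scale (k : R[i]) f : Cdecaying f -> Cdecaying (fun t => k * f t).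
Proof.
move=> df; rewrite (_ : (fun _ => _) = fun t => k * f t + 0).
  exact: Cdecaying_lincomb Cdecaying0.
by apply/funext => t; rewrite addr0.
Qed.

End ComplexDecay.

Section SpectralRep.
Variables (R : realType) (mu : {measure set R -> \bar R}) (a : R).
Variables (mua : {measure set R -> \bar R}) (V : (R -> R[i]) -> R -> R[i]).
Hypothesis mu_fin : (\int[mu]_t ((1 + `|t|)^-1 : R)%:E < +oo)%E.
Hypothesis hV : spectral_rep mu a mua V.

(** [srep_lin] speaks of [c f + g] only, so [V 0 = 0] almost everywhere is obtained first, from
    [V 0 = - V 0 + V 0]. *)
Lemma srep_scale (k : R[i]) f : L2 mu f ->
  ae_eqC mua (V (fun t => k * f t)) (fun s => k * V f s).
Proof.
move=> f2.
have L0 : L2 mu (fun=> 0) by apply: Cdecaying_L2 => //; exact: Cdecaying0.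
have V0 : ae_eqC mua (V (fun=> 0)) (fun=> 0).
  apply: filterS (srep_lin hV (-1) L0 L0) => s.
  by rewrite (_ : (fun _ => _) = fun=> 0) ?mulN1r ?addNr//; apply/funext => t; rewrite mulr0 addr0.
apply: filterS2 V0 (srep_lin hV k f2 L0) => s h0.
rewrite (_ : (fun t => k * f t + 0) = fun t => k * f t); last first.
  by apply/funext => t; rewrite addr0.
by move=> ->; rewrite h0 addr0.
Qed.

Lemma srep_lincomb (k1 k2 : R[i]) f g : L2 mu f -> L2 mu g ->
  L2 mu (fun t => k2 * g t) ->
  ae_eqC mua (V (fun t => k1 * f t + k2 * g t)) (fun s => k1 * V f s + k2 * V g s).
Proof.
move=> f2 g2 kg2.
by apply: filterS2 (srep_lin hV k1 f2 kg2) (srep_scale k2 g2) => s -> ->.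
Qed.

Variable c : R.

Definition ker (e t : R) : R[i] := Complex (clor c t) (e * lor c t).

Lemma Cdecaying_ker e : Cdecaying (ker e).
Proof.
split; first exact: C1bounded_decaying (@C1bounded_clor _ _).
by apply: decayingZ; exact: C1bounded_decaying (@C1bounded_lor _ _).
Qed.

Lemma Cdecaying_kerM e (g : R -> R) : decaying g ->
  Cdecaying (fun t => ker e t * (g t)%:C).
Proof.
move=> dg; have [d1 d2] := Cdecaying_ker e; split.
  rewrite (_ : (fun _ => _) = fun t => Re (ker e t) * g t).
    exact: decayingM.
  by apply/funext => t; rewrite /= mulr0 subr0.
rewrite (_ : (fun _ => _) = fun t => Im (ker e t) * g t).
  exact: decayingM.
by apply/funext => t; rewrite /= mulr0 add0r.
Qed.

Lemma nonreal_pole (e : R) : e ^+ 2 = 1 -> nonreal (Complex c e).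
Proof.
by move=> e1; apply/eqP => /= e0; move: e1; rewrite e0 expr0n/= => /esym/eqP; rewrite oner_eq0.
Qed.

Lemma Cint_kerM e (g : R -> R) :
  decaying g ->
  Cint mu (fun t => (g t)%:C * ker e t) =
  Complex (Rintegral mu setT (fun t => clor c t * g t))
          (e * Rintegral mu setT (fun t => lor c t * g t)).
Proof.
move=> dg; rewrite /Cint; congr Complex.
  by apply: eq_Rintegral => t _ /=; rewrite mul0r subr0 mulrC.
rewrite -RintegralZl//.
  by apply: eq_Rintegral => t _ /=; rewrite mul0r addr0; ring.
apply: (decaying_integrable mu_fin); apply: decayingM => //.
exact: C1bounded_decaying (@C1bounded_lor _ _).
Qed.

(** Adding [a (int g k dmu)] times [resolvent1] to the resolvent of [g] cancels the rank one
    correction and leaves [k g]. [V] sends these two terms to [a (int g k dmu) k] and [k (V g)]. *)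
Lemma srep_kerM (e : R) (g : R -> R) : e ^+ 2 = 1 -> decaying g ->
  ae_eqC mua (V (fun t => ker e t * (g t)%:C))
    (fun s => ker e s * V (fun t => (g t)%:C) s + a%:C *
      Complex (Rintegral mu setT (fun t => clor c t * g t))
              (e * Rintegral mu setT (fun t => lor c t * g t)) * ker e s).
Proof.
move=> e1 dg.
pose l := Complex c e; pose g' := fun t => (g t)%:C.
have nl := nonreal_pole e1.
have kE t : (t%:C - l)^-1 = ker e t by exact: resolvent_kernelE.
have CE : Cint mu (fun t => g' t * (t%:C - l)^-1) = Complex
    (Rintegral mu setT (fun t => clor c t * g t))
    (e * Rintegral mu setT (fun t => lor c t * g t)).
  by rewrite -Cint_kerM//; congr (Cint mu _); apply/funext => t; rewrite kE.
have r1E : resolvent1 mu a l = fun t => (1 + a%:C * cauchyT mu l)^-1 * ker e t.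
  by apply/funext => t; rewrite /resolvent1 kE.
have d1 : Cdecaying (resolvent1 mu a l).
  by rewrite r1E; apply: Cdecaying_scale; exact: Cdecaying_ker.
have rE : resolvent mu a l g' = fun t =>
    (- (a%:C * Cint mu (fun t => g' t * (t%:C - l)^-1) / (1 + a%:C * cauchyT mu l))) * ker e t
    + ker e t * (g t)%:C.
  by apply/funext => t; rewrite /resolvent kE mulNr addrC.
have d2 : Cdecaying (resolvent mu a l g').
  by rewrite rE; apply: Cdecaying_lincomb; [exact: Cdecaying_ker|exact: Cdecaying_kerM].
have L2g' : L2 mu g' by apply: Cdecaying_L2 => //; exact: Cdecaying_real.
have := srep_lin hV (a%:C * Cint mu (fun t => g' t * (t%:C - l)^-1))
  (Cdecaying_L2 mu_fin d1) (Cdecaying_L2 mu_fin d2).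
rewrite (_ : (fun t => _ + _) = fun t => ker e t * (g t)%:C); last first.
  by apply/funext => t; rewrite r1E rE; ring.
apply: filterS3 (srep_res1 hV nl) (srep_res hV nl L2g') => s h1 h2 ->.
by rewrite h1 h2 kE CE addrC.
Qed.

End SpectralRep.

(** * Functions on which [V] agrees with the integral formula *)

Section GoodFunctions.
Variables (R : realType) (mu : {measure set R -> \bar R}) (a : R).
Variables (mua : {measure set R -> \bar R}) (V : (R -> R[i]) -> R -> R[i]).
Hypothesis mu_neq0 : mu setT != 0%E.
Hypothesis mu_fin : (\int[mu]_t ((1 + `|t|)^-1 : R)%:E < +oo)%E.
Hypothesis hV : spectral_rep mu a mua V.

Definition pertT (g : R -> R) (s : R) : R := g s - a * Rintegral mu setT (dq g s).

(** The bound places [g] in [L^2(mu)] and makes [dq g s] integrable, so both sides of the identity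
    are meaningful. *)
Definition good (g : R -> R) : Prop :=
  (exists M, C1bounded M g) /\
  ae_eqC mua (V (fun t => (g t)%:C)) (fun s => (pertT g s)%:C).

Lemma C1bounded_L2 M g : C1bounded M g -> L2 mu (fun t => (g t)%:C).
Proof.
move=> gM; apply: Cdecaying_L2 => //; apply: Cdecaying_real.
exact: C1bounded_decaying gM.
Qed.

Lemma integrable_dq M g s : C1bounded M g -> mu.-integrable setT (EFin \o dq g s).
Proof. by move=> gM; apply: decaying_integrable => //; exact: dq_decaying gM. Qed.

Lemma good_lincomb (k : R) f g : good f -> good g -> good (fun t => k * f t + g t).
Proof.
move=> [[M fM] fV] [[N gN] gV]; split.
  by exists (`|k| * M + N); exact: C1bounded_lincomb.
apply: filterS3 fV gV (srep_lin hV k%:C (C1bounded_L2 fM) (C1bounded_L2 gN)) => s fs gs.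
rewrite (_ : (fun t => _ + _) = fun t => (k * f t + g t)%:C); last first.
  by apply/funext => t; rewrite rmorphD rmorphM.
move=> ->; rewrite fs gs -rmorphM -rmorphD /pertT; congr (_%:C).
rewrite [X in _ = _ - a * X](_ : _ = k * Rintegral mu setT (dq f s) + Rintegral mu setT (dq g s)).
  by ring.
have fi := integrable_dq s fM; have gi := integrable_dq s gN.
rewrite -RintegralZl// -RintegralD//; last exact: (integrableZl measurableT k fi).
apply: eq_Rintegral => t _; apply: dq_lincomb; first by case: (fM s).
by case: (gN s).
Qed.

Lemma good_scale (k : R) f : good f -> good (fun t => k * f t).
Proof.
move=> gf; have := good_lincomb (k - 1) gf gf.
by congr good; apply/funext => t; ring.
Qed.

Variable c : R.
Local Notation u := (lor c).
Local Notation v := (clor c).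

(** Recovers [lor = (k_+ - k_-)/(2 i)] and [clor = (k_+ + k_-)/2] from the kernels [k_+], [k_-] of
    the poles [c + i], [c - i]. [G] stands for the image of [g]; it is abstract so as to cover
    [g = 1], [G = 1], where [1] may lie outside [L^2(mu)]. *)
Lemma srep_ker_split (g : R -> R) (G : R -> R[i]) (A B : R) :
  (forall e, Cdecaying (fun t => ker c e t * (g t)%:C)) ->
  (forall e : R, e ^+ 2 = 1 -> ae_eqC mua (V (fun t => ker c e t * (g t)%:C))
     (fun s => ker c e s * G s + a%:C * Complex A (e * B) * ker c e s)) ->
  ae_eqC mua (V (fun t => (u t * g t)%:C))
     (fun s => (u s)%:C * G s + (a * (A * u s + B * v s))%:C) /\
  ae_eqC mua (V (fun t => (v t * g t)%:C))
     (fun s => (v s)%:C * G s + (a * (A * v s - B * u s))%:C).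
Proof.
move=> d H.
have L e := Cdecaying_L2 mu_fin (d e).
have L' e k := Cdecaying_L2 mu_fin (Cdecaying_scale k (d e)).
have H1 := H 1 (expr1n _ _); have H2 := H (-1) (etrans (sqrrN 1) (expr1n _ _)).
split.
  have := srep_lincomb mu_fin hV (Complex 0 (- 2^-1)) (L 1) (L (-1)) (L' (-1) (Complex 0 (2^-1))).
  rewrite (_ : (fun t => _ + _) = fun t => (u t * g t)%:C); last first.
    by apply/funext => t; apply/eqP; rewrite eq_complex /=; apply/andP; split; apply/eqP; field.
  apply: filterS3 H1 H2 => s -> -> ->.
  apply/eqP; rewrite eq_complex; case: (G s) => G1 G2 /=.
  by apply/andP; split; apply/eqP; field.
have := srep_lincomb mu_fin hV (Complex (2^-1) 0) (L 1) (L (-1)) (L' (-1) (Complex (2^-1) 0)).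
rewrite (_ : (fun t => _ + _) = fun t => (v t * g t)%:C); last first.
  by apply/funext => t; apply/eqP; rewrite eq_complex /=; apply/andP; split; apply/eqP; field.
apply: filterS3 H1 H2 => s -> -> ->.
apply/eqP; rewrite eq_complex; case: (G s) => G1 G2 /=.
by apply/andP; split; apply/eqP; field.
Qed.

(** A strictly positive function has zero integral only for the zero measure. Up to sign this
    integral is the imaginary part of [F(c + i)] and [F(c - i)]. *)
Lemma Rintegral_lor_gt0 : 0 < Rintegral mu setT u.
Proof.
have du := C1bounded_decaying (@C1bounded_lor R c).
rewrite lt_neqAle Rintegral_ge0 ?andbT; last by move=> t _; exact/ltW/lor_gt0.
apply/negP => /eqP I0; move/negP: mu_neq0; apply; apply/eqP.
have ui := decaying_integrable mu_fin du.
have : (\int[mu]_t `|(u t)%:E| = 0)%E.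
  under eq_integral do rewrite gee0_abs ?lee_fin ?(ltW (lor_gt0 _ _))//.
  by rewrite -[LHS]fineK; [rewrite -[fine _]/(Rintegral mu setT u) -I0|exact: integrable_fin_num].
move/(ae_eq_integral_abs _ measurableT (measurable_int _ ui)) => [N [mN N0 hN]].
apply: (@subset_measure0 _ _ _ mu _ N) => // t _; apply: hN => /= /(_ Logic.I) [].
by apply/eqP; rewrite gt_eqF// lor_gt0.
Qed.

(** The counterpart of [srep_kerM] for [g = 1]. Since [1] need not be in [L^2(mu)], the kernel is
    written as [1 + a F] times [resolvent1], which requires [1 + a F] to be nonzero. *)
Lemma srep_ker (e : R) : e ^+ 2 = 1 ->
  ae_eqC mua (V (ker c e))
    (fun s => ker c e s + a%:C *
      Complex (Rintegral mu setT v) (e * Rintegral mu setT u) * ker c e s).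
Proof.
move=> e1; pose l := Complex c e.
have nl := nonreal_pole c e1.
have kE t : (t%:C - l)^-1 = ker c e t by exact: resolvent_kernelE.
have du := C1bounded_decaying (@C1bounded_lor R c).
have FE : cauchyT mu l = Complex (Rintegral mu setT v) (e * Rintegral mu setT u).
  rewrite /cauchyT /Cint; congr Complex.
    by apply: eq_Rintegral => t _; rewrite kE.
  rewrite -RintegralZl//; last exact: (decaying_integrable mu_fin du).
  by apply: eq_Rintegral => t _; rewrite kE.
(* The imaginary part is [a e] times the positive integral of [lor]; it vanishes only for [a = 0],
   and then the real part is 1. *)
have D0 : 1 + a%:C * cauchyT mu l != 0.
  apply/eqP; rewrite FE => /eqP; rewrite eq_complex /= => /andP[/eqP h1 /eqP h2].
  have /eqP : a * (e * Rintegral mu setT u) = 0 by move: h2; rewrite mul0r !(addr0, add0r).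
  rewrite !mulf_eq0 (gt_eqF Rintegral_lor_gt0) orbF => /orP[/eqP a0|/eqP e0].
    by move: h1; rewrite a0 !mul0r subr0 addr0 => /eqP; rewrite oner_eq0.
  by move: e1; rewrite e0 expr0n/= => /esym/eqP; rewrite oner_eq0.
have r1E : resolvent1 mu a l = fun t => (1 + a%:C * cauchyT mu l)^-1 * ker c e t.
  by apply/funext => t; rewrite /resolvent1 kE.
have d1 : Cdecaying (resolvent1 mu a l).
  by rewrite r1E; apply: Cdecaying_scale; exact: Cdecaying_ker.
have := srep_scale mu_fin hV (1 + a%:C * cauchyT mu l) (Cdecaying_L2 mu_fin d1).
rewrite (_ : (fun t => _ * _) = ker c e); last first.
  by apply/funext => t; rewrite r1E mulrA mulfV// mul1r.
apply: filterS2 (srep_res1 hV nl) => s h1 ->.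
by rewrite h1 kE -FE mulrDl mul1r.
Qed.

Lemma good_lor_clor : good u /\ good v.
Proof.
have du := C1bounded_decaying (@C1bounded_lor R c).
have dv := C1bounded_decaying (@C1bounded_clor R c).
have ui := decaying_integrable mu_fin du; have vi := decaying_integrable mu_fin dv.
have kE e : (fun t => ker c e t * (1 : R)%:C) = ker c e.
  by apply/funext => t; rewrite mulr1.
have d e : Cdecaying (fun t => ker c e t * (1 : R)%:C).
  by rewrite kE; exact: Cdecaying_ker.
have [|hu hv] := @srep_ker_split (fun=> 1) (fun=> 1)
  (Rintegral mu setT v) (Rintegral mu setT u) d.
  move=> e e1; rewrite kE; apply: filterS (srep_ker e1) => s ->.
  by rewrite mulr1.
split.
  split; first by exists (3 + `|c|); exact: C1bounded_lor.
  apply: filterS hu => s; rewrite (_ : (fun t => _) = fun t => (u t)%:C); last first.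
    by apply/funext => t; rewrite mulr1.
  move=> ->; rewrite mulr1 -rmorphD /pertT; congr (_%:C).
  rewrite [Rintegral mu setT (dq _ s)](@eq_Rintegral _ _ _ mu setT
    (fun t : R => - v s * u t + - u s * v t)); last first.
    by move=> t _; rewrite -[LHS]/(dq _ s t) dq_lor; ring.
  rewrite RintegralD//; [|exact: (integrableZl measurableT _ ui)|
    exact: (integrableZl measurableT _ vi)].
  by rewrite !RintegralZl//; ring.
split; first by exists (3 + `|c|); exact: C1bounded_clor.
apply: filterS hv => s; rewrite (_ : (fun t => _) = fun t => (v t)%:C); last first.
  by apply/funext => t; rewrite mulr1.
move=> ->; rewrite mulr1 -rmorphD /pertT; congr (_%:C).
rewrite [Rintegral mu setT (dq _ s)](@eq_Rintegral _ _ _ mu setT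
    (fun t : R => u s * u t + - v s * v t)); last first.
  by move=> t _; rewrite -[LHS]/(dq _ s t) dq_clor; ring.
rewrite RintegralD//; [|exact: (integrableZl measurableT _ ui)|
    exact: (integrableZl measurableT _ vi)].
by rewrite !RintegralZl//; ring.
Qed.

(** By [dqM] and [dq_lor], the integral formula applied to [u g] is [u] times its value on [g] plus
    [a (u int v g dmu + v int u g dmu)], which is exactly what [srep_ker_split] gives for [V]. *)
Lemma good_lorM g : good g -> good (fun t => u t * g t).
Proof.
move=> [[M gM] gV].
have du := C1bounded_decaying (@C1bounded_lor R c).
have dv := C1bounded_decaying (@C1bounded_clor R c).
have dg := C1bounded_decaying gM.
have ugi := decaying_integrable mu_fin (decayingM du dg).
have vgi := decaying_integrable mu_fin (decayingM dv dg).
split; first by exists (2 * ((3 + `|c|) * M)); exact: C1boundedM (@C1bounded_lor R c) gM.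
have [|hu _] := @srep_ker_split g (V (fun t => (g t)%:C))
  (Rintegral mu setT (fun t => v t * g t)) (Rintegral mu setT (fun t => u t * g t))
  (fun e => Cdecaying_kerM c e dg).
  by move=> e e1; exact: (srep_kerM mu_fin hV c e1 dg).
apply: filterS2 gV hu => s gs ->; rewrite gs -rmorphM -rmorphD /pertT; congr (_%:C).
have gi := integrable_dq s gM.
have -> : Rintegral mu setT (dq (fun t => u t * g t) s) = Rintegral mu setT
    (fun t => u s * dq g s t + (- v s * (u t * g t) + - u s * (v t * g t))).
  apply: eq_Rintegral.
  move=> t _; rewrite -[LHS]/(dq (fun t => u t * g t) s t) dqM ?dq_lor; [ring| |by case: (gM s)].
  by case: (@C1bounded_lor R c s).
have i1 := integrableZl measurableT (- v s) ugi.
have i2 := integrableZl measurableT (- u s) vgi.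
rewrite RintegralD//; [|exact: (integrableZl measurableT _ gi)|
  exact: (integrableD measurableT i1 i2)].
by rewrite RintegralD// !RintegralZl//; ring.
Qed.

Lemma good_lor_poly (p : {poly R}) :
  good (fun t => p.[u t] * u t) /\ good (fun t => p.[u t] * v t).
Proof.
have [gu gv] := good_lor_clor.
suff H g : good g -> good (fun t => p.[u t] * g t) by split; exact: H.
(* Horner's scheme: [(p X + k)(u) g = k g + u (p(u) g)]. *)
move=> gg; elim/poly_ind: p => [|p k IH].
  have := good_scale 0 gg; congr good; apply/funext => t.
  by rewrite hornerC.
have := good_lincomb k gg (good_lorM IH).
congr good; apply/funext => t; rewrite hornerD hornerMX hornerC; ring.
Qed.

End GoodFunctions.

(** * Passage to the limit in the identity *)

(** By Fatou the pointwise lower limit has integral zero, hence vanishes almost everywhere, and any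
    pointwise limit equals it. This takes the place of extracting an almost everywhere convergent
    subsequence. *)
Lemma ae_lim0_of_Rintegral_cvg0 (R : realType) (nu : {measure set R -> \bar R})
    (h : nat -> R -> R) :
  (forall n s, 0 <= h n s) ->
  (forall n, nu.-integrable setT (EFin \o h n)) ->
  Rintegral nu setT (h n) @[n --> \oo] --> 0 ->
  {ae nu, forall s, forall l : R, h n s @[n --> \oo] --> l -> l = 0}.
Proof.
move=> h0 hi hc.
have mh n : measurable_fun setT (fun s => (h n s)%:E) := measurable_int _ (hi n).
pose H s := limn_einf (fun n => (h n s)%:E).
have mH : measurable_fun setT H.
  apply: measurableT_comp => //.
  apply: (measurable_fun_limn_esup (f := fun n s => (- (h n s)%:E)%E)) => n.
  exact: measurableT_comp.
have H0 s : (0 <= H s)%E.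
  rewrite /H limn_einf_lim; apply: lime_ge; first exact: is_cvg_einfs.
  by apply: nearW => n; apply: le_ereal_inf_tmp => _ [m /= nm <-]; rewrite lee_fin.
have IH : (\int[nu]_s H s = 0)%E.
  apply/eqP; rewrite eq_le integral_ge0 ?andbT//.
  have f0 n s : setT s -> (0 <= (h n s)%:E)%E by rewrite lee_fin.
  apply: le_trans (fatou nu measurableT mh f0) _.
  suff hcv : (\int[nu]_s (h n s)%:E)%E @[n --> \oo] --> 0%E.
    by rewrite (cvg_limn_einf_sup hcv).1.
  rewrite (_ : (fun n => _) = EFin \o (fun n => Rintegral nu setT (h n))).
    by apply: cvg_EFin => //; exact: nearW.
  by apply/funext => n /=; rewrite fineK//; exact: (integrable_fin_num measurableT (hi n)).
have : (\int[nu]_s `|H s| = 0)%E.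
  by rewrite -[RHS]IH; apply: eq_integral => s _; rewrite gee0_abs.
move/(ae_eq_integral_abs nu measurableT mH); apply: filterS => s /(_ Logic.I) Hs l hl.
have hl' : (h n s)%:E @[n --> \oo] --> l%:E.
  by apply: cvg_EFin => //; exact: nearW.
by have := (cvg_limn_einf_sup hl').1; rewrite -/(H s) Hs => -[].
Qed.

Section GoodLimit.
Variables (R : realType) (mu : {measure set R -> \bar R}) (a : R).
Variables (mua : {measure set R -> \bar R}) (V : (R -> R[i]) -> R -> R[i]).
Hypothesis mu_fin : (\int[mu]_t ((1 + `|t|)^-1 : R)%:E < +oo)%E.
Hypothesis hV : spectral_rep mu a mua V.

Lemma Csqnorm_ge0 (z : R[i]) : 0 <= Csqnorm z.
Proof. by rewrite addr_ge0// sqr_ge0. Qed.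

Lemma Csqnorm_eq0 (z : R[i]) : Csqnorm z = 0 -> z = 0.
Proof.
move=> /eqP; rewrite paddr_eq0 ?sqr_ge0// !sqrf_eq0 => h.
by apply/eqP; rewrite eq_complex.
Qed.

(** [V g_n] tends to [V f] in [L^2(mua)] because [V] is an isometry, while [V g_n = pertT g_n] tends
    pointwise to [pertT f]; the two limits agree almost everywhere. Convergence of the derivatives
    serves the diagonal value of the difference quotient. *)
Lemma good_limit (g : nat -> R -> R) (f : R -> R) (M : R) :
  (forall n, good mu a mua V (g n)) -> (forall n, C1bounded M (g n)) ->
  C1bounded M f ->
  (forall t, g n t @[n --> \oo] --> f t) ->
  (forall t, (g n)^`()%classic t @[n --> \oo] --> f^`()%classic t) ->
  good mu a mua V f.
Proof.
move=> gg gM fM gf dgf; split; first by exists M.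
have M0 : 0 <= M by apply: le_trans (normr_ge0 _) _; case: (fM 0) => _ _; exact.
(* A countable union of null sets gives one exceptional set for all [n]. *)
have gV : {ae mua, forall s, forall n, V (fun t => (g n t)%:C) s = (pertT mu a (g n) s)%:C}.
  by apply: ae_foralln => n; case: (gg n).
have L2f := C1bounded_L2 mu_fin fM; have L2g n := C1bounded_L2 mu_fin (gM n).
pose w n t := -1 * g n t + f t.
have wM n : C1bounded (`|-1| * M + M) (w n) by exact: C1bounded_lincomb.
have L2w n := C1bounded_L2 mu_fin (wM n).
have wV : {ae mua, forall s, forall n, V (fun t => (w n t)%:C) s =
    -1 * V (fun t => (g n t)%:C) s + V (fun t => (f t)%:C) s}.
  apply: ae_foralln => n; apply: filterS (srep_lin hV (-1) (L2g n) L2f) => s.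
  rewrite (_ : (fun t => _ + _) = fun t => (w n t)%:C)//.
  by apply/funext => t; rewrite rmorphD rmorphM rmorphN rmorph1.
have w_le n t : `|w n t| <= 2 * M.
  apply: le_trans (ler_normS _ t) _; have [_ + _] := wM n t.
  by rewrite normrN1; move=> /le_trans; apply; rewrite mul1r mulr2n mulrDl mul1r.
(* Transported to [mu] by the isometry, where [w_n^2] is dominated by [4 M^2/(1 + |t|)]. *)
have I0 : Rintegral mua setT (fun s => Csqnorm (V (fun t => (w n t)%:C) s))
    @[n --> \oo] --> 0.
  rewrite (_ : (fun n => _) = fun n => Rintegral mu setT (fun t => w n t ^+ 2)); last first.
    apply/funext => n; rewrite (srep_iso hV (L2w n)); apply: eq_Rintegral => t _.
    by rewrite /Csqnorm /= [X in _ + X]expr0n addr0.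
  have -> : 0 = Rintegral mu setT (fun=> 0 : R).
    by rewrite /Rintegral integral0.
  apply: (@Rintegral_dominated _ _ mu_fin _ _ (2 * M * (2 * M))).
  - move=> n; apply: measurable_funX.
    exact: (C1bounded_decaying (wM n)).1.
  - move=> n t; rewrite expr2 normrM -[leLHS]mulrA; apply: ler_pM; rewrite ?w_le//.
    have [_ + _] := wM n t.
    by rewrite normrN1; move=> /le_trans; apply; rewrite mul1r mulr2n mulrDl mul1r.
  - move=> t; rewrite -[X in _ --> X](_ : (-1 * f t + f t) * (-1 * f t + f t) = 0).
      under eq_fun do rewrite expr2.
      by apply: cvgM; apply: cvgD; (try exact: cvg_cst); apply: cvgMr.
    by rewrite mulN1r addNr mul0r.
have Tlim s : pertT mu a (g n) s @[n --> \oo] --> pertT mu a f s.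
  apply: cvgB; first exact: gf.
  apply: cvgMr; apply: (@Rintegral_dominated _ _ mu_fin _ _ (M * (3 + `|s|))).
  - by move=> n; apply: (measurable_dq s (gM n)).
  - by move=> n t; exact: dq_decay.
  - move=> t; rewrite /dq; case: eqP => _; first exact: dgf.
    by apply: cvgMl; apply: cvgB; exact: gf.
have Vi n : mua.-integrable setT (EFin \o (fun s => Csqnorm (V (fun t => (w n t)%:C) s))).
  by have [] := srep_L2 hV (L2w n).
have := ae_lim0_of_Rintegral_cvg0 (fun n s => Csqnorm_ge0 _) Vi I0.
(* At such [s], [V w_n = V f - pertT g_n], so the squared norms converge to that of [V f - pertT f],
   which must therefore be 0. *)
apply: filterS3 gV wV => s gVs wVs /(_ (Csqnorm (V (fun t => (f t)%:C) s - (pertT mu a f s)%:C))) H.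
apply/eqP; rewrite -subr_eq0; apply/eqP/Csqnorm_eq0/H.
under eq_fun do rewrite wVs gVs.
move: (V _ s) => [x y].
rewrite (_ : (fun n => _) = fun n => (x - pertT mu a (g n) s) ^+ 2 + y ^+ 2); last first.
  by apply/funext => n; rewrite /Csqnorm /=; ring.
rewrite (_ : Csqnorm _ = (x - pertT mu a f s) ^+ 2 + y ^+ 2); last first.
  by rewrite /Csqnorm /=; ring.
apply: cvgD; last exact: cvg_cst.
rewrite expr2; under eq_fun do rewrite expr2.
by apply: cvgM; apply: cvgB; (try exact: cvg_cst); exact: Tlim.
Qed.

End GoodLimit.

(** * Bernstein approximation in the variable [lor c] *)

Section BernsteinApproximation.
Variable R : realType.

(** The samples may depend on [n] and the degree may lag the grid by one: values of [phi] use degree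
    [n.+1], difference quotients of [phi] use degree [n]. *)
Lemma bern_cvg (m : nat -> nat) (h : nat -> nat -> R) (L M x : R) :
  0 <= x <= 1 -> (forall n, (m n <= n.+1 <= (m n).+1)%N) ->
  (forall n k, `|h n k - L| <= M) ->
  (forall e, 0 < e -> exists2 d, 0 < d & \forall n \near \oo,
     forall k, `|k%:R / n.+1%:R - x| < d -> `|h n k - L| <= e) ->
  (bern (m n) (h n)).[x] @[n --> \oo] --> L.
Proof.
move=> x01 mn hM he.
have M0 : 0 <= M by apply: le_trans (hM 0%N 0%N).
apply/cvgrPdist_le => e e0.
have e2 : 0 < e / 2 by rewrite divr_gt0.
have [d d0 hd] := he _ e2.
pose C := M / d ^+ 2 * 2.
have C0 : 0 <= C by rewrite mulr_ge0// divr_ge0// exprn_ge0// ltW.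
near=> n.
have hdn : forall k, `|k%:R / n.+1%:R - x| < d -> `|h n k - L| <= e / 2.
  by near: n; exact: hd.
rewrite distrC.
apply: (@le_trans _ _ (e / 2 + M / d ^+ 2 * (2 / n.+1%:R))).
  by apply: bern_near => //; exact: ltW.
rewrite [leRHS](splitr e) lerD2l mulrA -/C ler_pdivrMr ?ltr0n//.
rewrite mulrC -ler_pdivrMr//.
near: n; exists (Num.truncn (C / (e / 2))) => // n /= hn.
apply/ltW/(lt_le_trans (truncnS_gt _)).
by rewrite ler_nat.
Unshelve. all: by end_near. Qed.

Variables (phi : R -> R) (M : R).
Hypothesis phi_der : forall y, derivable phi y 1.
Hypothesis phi'_cont : continuous phi^`()%classic.
Hypothesis phi_bd : forall y, `|phi y| <= M.
Hypothesis phi'_bd : forall y, `|phi^`()%classic y| <= M.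
Hypothesis phi0 : phi 0 = 0.

Definition bernstein (n : nat) : {poly R} :=
  bern n.+1 (fun k => phi (k%:R / n.+1%:R)).

Let phi_lip := mean_value_norm phi_der phi'_bd.

(** Since [phi 0 = 0], the samples satisfy [|phi(k/(n+1))| <= M k/(n+1)], and Bernstein polynomials
    reproduce the identity. The factor [x] becomes the decay of [lor] after substituting
    [x = lor c t]. *)
Lemma le_normr_bernstein n x : 0 <= x <= 1 -> `|(bernstein n).[x]| <= M * x.
Proof.
move=> x01.
apply: (@le_trans _ _ (bern n.+1 (fun k => M / n.+1%:R * k%:R)).[x]).
  apply: bern_norm_le => // k.
  rewrite -[phi _]subr0 -[X in _ - X]phi0; apply: le_trans (phi_lip _ _) _.
  by rewrite subr0 ger0_norm ?divr_ge0// mulrAC mulrA.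
by rewrite bernZ bern_id mulrA divfK ?pnatr_eq0.
Qed.

Lemma deriv_bernstein n x : (bernstein n)^`().[x] =
  (bern n (fun k => n.+1%:R * (phi (k.+1%:R / n.+1%:R) - phi (k%:R / n.+1%:R)))).[x].
Proof. by rewrite deriv_bern bernZ mulr_natl hornerMn mulr_natl. Qed.

Lemma le_normr_deriv_bernstein n x : 0 <= x <= 1 ->
  `|(bernstein n)^`().[x]| <= M.
Proof.
move=> x01; rewrite deriv_bernstein -[leRHS](bern_cst n _ x).
apply: bern_norm_le => // k; rewrite normrM normr_nat.
apply: (@le_trans _ _ (n.+1%:R * (M * `|k.+1%:R / n.+1%:R - k%:R / n.+1%:R|))).
  by rewrite ler_wpM2l.
rewrite -mulrBl -[k.+1]add1n natrD addrK ger0_norm ?divr_ge0//.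
by rewrite mulrCA mul1r mulfV ?mulr1// pnatr_eq0.
Qed.

Lemma bernstein_cvg (x : R) : 0 <= x <= 1 -> (bernstein n).[x] @[n --> \oo] --> phi x.
Proof.
move=> x01; apply: (@bern_cvg succn (fun n k => phi (k%:R / n.+1%:R)) _ (M + M)) => //.
- by move=> n; rewrite leqnn leqnSn.
- by move=> n k; apply: le_trans (ler_normB _ _) _; rewrite lerD.
- move=> e e0.
  have cphi : {for x, continuous phi}.
    by apply: differentiable_continuous; apply/derivable1_diffP.
  move/cvgrPdist_le : cphi => /(_ e e0)/nbhs_ballP[d /= d0 hd].
  exists d => //; apply: nearW => n k kd; rewrite distrC; apply: hd.
  by rewrite /ball /= distrC.
Qed.

(** By the mean value theorem, each coefficient is a value of [phi'] between two neighbouring grid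
    points, so continuity of [phi'] at [x] suffices. *)
Lemma deriv_bernstein_cvg (x : R) : 0 <= x <= 1 ->
  (bernstein n)^`().[x] @[n --> \oo] --> phi^`()%classic x.
Proof.
move=> x01; under eq_fun do rewrite deriv_bernstein.
have mvt n k : exists2 y, k%:R / n.+1%:R <= y <= k.+1%:R / n.+1%:R &
    n.+1%:R * (phi (k.+1%:R / n.+1%:R) - phi (k%:R / n.+1%:R)) = phi^`()%classic y.
  have kk : k%:R / n.+1%:R <= k.+1%:R / n.+1%:R :> R.
    by rewrite ler_pM2r ?invr_gt0 ?ltr0n// ler_nat.
  have [||y yk ->] := @MVT_segment R phi phi^`()%classic _ _ kk.
  - by move=> y _; rewrite derive1E; exact: derivableP.
  - apply: continuous_subspaceT => y.
    by apply: differentiable_continuous; apply/derivable1_diffP.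
  - exists y; first by rewrite in_itv /= in yk.
    by rewrite -mulrBl -[k.+1]add1n natrD addrK mulrCA mul1r mulfV ?mulr1// pnatr_eq0.
apply: (@bern_cvg id (fun n k => n.+1%:R * (phi (k.+1%:R / n.+1%:R) - phi (k%:R / n.+1%:R)))
  _ (M + M)) => //.
- by move=> n; rewrite leqnn leqnSn.
- move=> n k; have [y _ ->] := mvt n k.
  by apply: le_trans (ler_normB _ _) _; rewrite lerD.
- move=> e e0.
  have cphi : phi^`()%classic y @[y --> x] --> phi^`()%classic x by exact: phi'_cont.
  move/cvgrPdist_le : cphi => /(_ e e0)/nbhs_ballP[d /= d0 hd].
  have d2 : 0 < d / 2 by rewrite divr_gt0.
  (* Half of [d] for the distance from [k/(n+1)] to [x], half for the mesh [1/(n+1)]. *)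
  exists (d / 2) => //.
  near=> n => k kd; have [y /andP[y1 y2] ->] := mvt n k.
  rewrite distrC; apply: hd; rewrite /ball /= distrC.
  have n2 : n.+1%:R^-1 <= d / 2.
    rewrite -[leRHS]invrK lef_pV2 ?posrE ?invr_gt0 ?ltr0n//.
    near: n; exists (Num.truncn (d / 2)^-1) => // n /= hn.
    by apply/ltW/(lt_le_trans (truncnS_gt _)); rewrite ler_nat.
  rewrite -[k.+1]add1n natrD mulrDl mul1r in y2.
  move: kd y1 y2 n2; rewrite !ltr_norml.
  move: (k%:R / n.+1%:R : R) (n.+1%:R^-1 : R) => q N /andP[h1 h2] y1 y2 n2.
  by apply/andP; split; lra.
Unshelve. all: by end_near. Qed.

End BernsteinApproximation.

(** * Functions [phi(u)] and [(t - c) phi(u)] with [u = lor c] *)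

Section LorentzComposition.
Variables (R : realType) (c : R).
Local Notation u := (lor c).
Local Notation v := (clor c).

Definition lor_comp (phi : R -> R) (t : R) : R := phi (u t).
Definition shift_lor_comp (phi : R -> R) (t : R) : R := (t - c) * phi (u t).

Section Derivatives.
Variable phi : R -> R.
Hypothesis phi_der : forall y, derivable phi y 1.

Lemma is_derive_lor_comp (t : R) : is_derive t (1 : R) (lor_comp phi)
  (phi^`()%classic (u t) * (- 2 * (t - c) * u t ^+ 2)).
Proof.
have hl := is_derive_lor c t.
have dl : derivable u t 1 by [].
apply: DeriveDef.
  apply/derivable1_diffP; apply: differentiable_comp; first exact/derivable1_diffP.
  exact/derivable1_diffP.
rewrite -derive1E -[lor_comp phi]/(phi \o u) derive1_comp//.
by rewrite [X in _ * X]derive1E derive_val.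
Qed.

Lemma is_derive_shift_lor_comp (t : R) : is_derive t (1 : R) (shift_lor_comp phi)
  (phi (u t) + (t - c) * (phi^`()%classic (u t) * (- 2 * (t - c) * u t ^+ 2))).
Proof.
have hl := is_derive_lor_comp t.
rewrite (_ : shift_lor_comp phi = (fun t => t - c) * lor_comp phi); last by apply/funext.
apply: is_derive_eq.
by rewrite -![_ *: _]/(_ * _) subr0 mulr1 addrC.
Qed.

Variable M : R.
Hypothesis phi_bd : forall y, 0 <= y <= 1 -> `|phi y| <= M * y.
Hypothesis phi'_bd : forall y, 0 <= y <= 1 -> `|phi^`()%classic y| <= M.

Let u01 t : 0 <= u t <= 1.
Proof. by rewrite ltW ?lor_gt0//= lor_le1. Qed.

Let M0 : 0 <= M.
Proof. by apply: le_trans (normr_ge0 _) (phi'_bd (u01 0)). Qed.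

Lemma C1bounded_lor_comp : C1bounded (M * (3 + `|c|)) (lor_comp phi).
Proof.
move=> t; have hd := is_derive_lor_comp t.
have hl := is_derive_lor c t.
have [_ l1 l2] := @C1bounded_lor _ c t.
have l0 := ltW (lor_gt0 c t).
split; first by [].
  apply: (@le_trans _ _ (M * u t * (1 + `|t|))).
    by rewrite ler_wpM2r ?phi_bd// ltW// normS_gt0.
  by rewrite -mulrA ler_wpM2l// -[X in X * _](ger0_norm l0).
rewrite derive1E derive_val normrM ler_pM ?phi'_bd//.
by move: l2; rewrite derive1E derive_val.
Qed.

(** The bound [M y] on [phi] absorbs the growing factor: [|(t - c) phi(u)| <= M |clor|]. In the
    derivative, [(t - c)^2 u^2 <= 1] leaves at most [M + 2 M]. *)
Lemma C1bounded_shift_lor_comp : C1bounded (M * (3 + `|c|)) (shift_lor_comp phi).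
Proof.
move=> t; have hd := is_derive_shift_lor_comp t.
have [_ l1 l2] := @C1bounded_clor _ c t.
have l0 := ltW (lor_gt0 c t).
split; first by [].
  apply: (@le_trans _ _ (`|t - c| * (M * u t) * (1 + `|t|))).
    by rewrite /shift_lor_comp normrM ler_wpM2r ?ler_wpM2l ?phi_bd// ltW// normS_gt0.
  rewrite mulrCA -mulrA ler_wpM2l//; apply: le_trans l1.
  by rewrite /clor normrM (ger0_norm l0).
rewrite derive1E derive_val.
apply: le_trans (ler_normD _ _) _.
have h1 : `|phi (u t)| <= M.
  by apply: le_trans (phi_bd (u01 t)) _; rewrite ler_piMr// lor_le1.
have ls0 : 0 <= (t - c) ^+ 2 * u t by rewrite mulr_ge0// sqr_ge0.
have h2 : (t - c) ^+ 2 * u t * u t <= 1 * 1.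
  by rewrite ler_pM// ?lor_sqr_le1// lor_le1.
have h20 : 0 <= (t - c) ^+ 2 * u t * u t by rewrite mulr_ge0.
have h3 : `|(t - c) * (phi^`()%classic (u t) * (- 2 * (t - c) * u t ^+ 2))| <= M * 2.
  rewrite [X in `|X|](_ : _ = phi^`()%classic (u t) *
    (- (2 * ((t - c) ^+ 2 * u t * u t)))); last by ring.
  rewrite normrM normrN ler_pM// ?phi'_bd// ger0_norm; lra.
have c0 := normr_ge0 c.
have : 0 <= M * `|c| by rewrite mulr_ge0.
by move=> h4; rewrite [leRHS]mulrDr; lra.
Qed.

End Derivatives.

Variables (mu : {measure set R -> \bar R}) (a : R).
Variables (mua : {measure set R -> \bar R}) (V : (R -> R[i]) -> R -> R[i]).
Hypothesis mu_neq0 : mu setT != 0%E.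
Hypothesis mu_fin : (\int[mu]_t ((1 + `|t|)^-1 : R)%:E < +oo)%E.
Hypothesis hV : spectral_rep mu a mua V.

(** Factoring [p = q X] gives [p(u) = q(u) lor] and [(t - c) p(u) = q(u) clor]. *)
Lemma good_lor_comp_poly (p : {poly R}) : p.[0] = 0 ->
  good mu a mua V (lor_comp (horner p)) /\
  good mu a mua V (shift_lor_comp (horner p)).
Proof.
move=> /eqP /factor_theorem[q ->].
have [g1 g2] := good_lor_poly mu_neq0 mu_fin hV c q.
split; [move: g1|move: g2]; congr (good _ _ _ _); apply/funext => t;
  rewrite /lor_comp /shift_lor_comp hornerM hornerXsubC subr0 /clor; ring.
Qed.

Lemma good_lor_comp (phi : R -> R) (M : R) :
  (forall y, derivable phi y 1) -> continuous phi^`()%classic ->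
  (forall y, `|phi y| <= M) -> (forall y, `|phi^`()%classic y| <= M) ->
  phi 0 = 0 ->
  good mu a mua V (lor_comp phi) /\ good mu a mua V (shift_lor_comp phi).
Proof.
move=> dphi cphi phiM dphiM phi0.
have M0 : 0 <= M by apply: le_trans (phiM 0).
have phi_bd y : 0 <= y <= 1 -> `|phi y| <= M * y.
  move=> /andP[y0 _]; rewrite -[phi y]subr0 -phi0 -{2}(ger0_norm y0) -{2}(subr0 y).
  exact: mean_value_norm.
pose p n := bernstein phi n.
have pd n y : derivable (horner (p n)) y 1 by exact: derivable_horner.
have pM n y : 0 <= y <= 1 -> `|(p n).[y]| <= M * y by exact: le_normr_bernstein.
have pdE n : (horner (p n))^`()%classic = horner (p n)^`() by rewrite derivE.
have pdM n y : 0 <= y <= 1 -> `|(horner (p n))^`()%classic y| <= M.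
  by move=> y01; rewrite pdE; exact: le_normr_deriv_bernstein.
have p0 n : (p n).[0] = 0.
  have := pM n 0; rewrite lexx ler01 mulr0 normr_le0 => /(_ isT) /eqP; exact.
have u01 t : 0 <= u t <= 1 by rewrite ltW ?lor_gt0//= lor_le1.
have pc t : (p n).[u t] @[n --> \oo] --> phi (u t) by exact: (bernstein_cvg dphi phiM).
have pdc t : (horner (p n))^`()%classic (u t) @[n --> \oo] --> phi^`()%classic (u t).
  under eq_fun do rewrite pdE.
  exact: (deriv_bernstein_cvg dphi cphi dphiM).
split.
- apply: (good_limit mu_fin hV (g := fun n => lor_comp (horner (p n))) (M := M * (3 + `|c|))).
  + by move=> n; case: (good_lor_comp_poly (p0 n)).
  + by move=> n; exact: (C1bounded_lor_comp (pd n) (pM n) (pdM n)).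
  + exact: C1bounded_lor_comp.
  + exact: pc.
  + move=> t; have hd := is_derive_lor_comp dphi t.
    rewrite [X in _ --> X]derive1E derive_val.
    under eq_fun => n.
      have hn := is_derive_lor_comp (pd n) t.
      rewrite derive1E derive_val; over.
    apply: cvgMl; exact: pdc.
- apply: (good_limit mu_fin hV (g := fun n => shift_lor_comp (horner (p n))) (M := M * (3 + `|c|))).
  + by move=> n; case: (good_lor_comp_poly (p0 n)).
  + by move=> n; exact: (C1bounded_shift_lor_comp (pd n) (pM n) (pdM n)).
  + exact: C1bounded_shift_lor_comp.
  + by move=> t; apply: cvgMr; exact: pc.
  + move=> t; have hd := is_derive_shift_lor_comp dphi t.
    rewrite [X in _ --> X]derive1E derive_val.
    under eq_fun => n.
      have hn := is_derive_shift_lor_comp (pd n) t.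
      rewrite derive1E derive_val; over.
    apply: cvgD; first exact: pc.
    by apply: cvgMr; apply: cvgMl; exact: pdc.
Qed.

End LorentzComposition.

(** * Functions of class C^1 as functions of [lor c] *)

Section C1At.
Variable R : realType.
Implicit Types (f g : R -> R) (y : R).

(** A local form of [C1R], so that functions can be treated piecewise; the derivative is
    existential, so closure properties need no formula for [derive1]. *)
Definition C1at f y : Prop := exists df : R -> R,
  (\forall z \near y, is_derive z (1 : R) f (df z)) /\ {for y, continuous df}.

Lemma C1at_continuous f y : C1at f y -> {for y, continuous f}.
Proof.
move=> [df [/nbhs_singleton hf _]].
by apply: differentiable_continuous; apply/derivable1_diffP.
Qed.

Lemma C1R_C1at f : C1R f <-> forall y, C1at f y.
Proof.
split=> [[df cf] y|H].
  exists f^`()%classic; split; last exact: cf.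
  by near=> z; rewrite derive1E; exact: derivableP.
split=> [y|y].
  by have [df [/nbhs_singleton hf _]] := H y.
have [df [hf cf]] := H y.
have E : \forall z \near y, df z = f^`()%classic z.
  by apply: filterS hf => z hz; rewrite derive1E derive_val.
rewrite /continuous_at -(nbhs_singleton E).
exact: (cvg_trans (@near_eq_cvg _ _ (nbhs y) _ _ _ E) cf).
Unshelve. all: by end_near. Qed.

Lemma C1at_near f g y : (\forall z \near y, f z = g z) -> C1at f y -> C1at g y.
Proof.
move=> fg [df [hf cf]]; exists df; split => //.
move/nbhs_interior: fg => fg; apply: filterS2 fg hf => z fgz hz.
exact: near_eq_is_derive fgz hz.
Qed.

Lemma C1at_cst (k : R) y : C1at (fun=> k) y.
Proof.
by exists (fun=> 0); split; [near=> z; exact: is_derive_cst|exact: cvg_cst].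
Unshelve. all: by end_near. Qed.

Lemma C1atD f g y : C1at f y -> C1at g y -> C1at (fun z => f z + g z) y.
Proof.
move=> [df [hf cf]] [dg [hg cg]]; exists (fun z => df z + dg z); split; last exact: cvgD.
by apply: filterS2 hf hg => z hf hg; exact: is_deriveD.
Qed.

Lemma C1atM f g y : C1at f y -> C1at g y -> C1at (fun z => f z * g z) y.
Proof.
move=> C1f C1g; have cf := C1at_continuous C1f; have cg := C1at_continuous C1g.
move: C1f C1g => [df [hf cdf]] [dg [hg cdg]].
exists (fun z => f z * dg z + g z * df z); split; last by apply: cvgD; apply: cvgM.
by apply: filterS2 hf hg => z hf hg; exact: is_deriveM.
Qed.

Lemma C1at_comp f g y : C1at f y -> C1at g (f y) -> C1at (fun z => g (f z)) y.
Proof.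
move=> C1f [dg [hg cdg]]; have cf := C1at_continuous C1f.
move: C1f => [df [hf cdf]].
exists (fun z => dg (f z) * df z); split; last first.
  by apply: cvgM => //; exact: (continuous_comp cf cdg).
have hgf : \forall z \near y, is_derive (f z) (1 : R) g (dg (f z)) by exact: cf _ hg.
apply: filterS2 hf hgf => z hfz hgz.
have d1 : derivable f z 1 by [].
have d2 : derivable g (f z) 1 by [].
apply: DeriveDef.
  apply/derivable1_diffP; apply: (differentiable_comp (f := f) (g := g));
    exact/derivable1_diffP.
by rewrite -derive1E -[fun z => _]/(g \o f) derive1_comp// !derive1E !derive_val.
Qed.

Lemma C1at_inv y : y != 0 -> C1at GRing.inv y.
Proof.
move=> y0; exists (fun z => - z ^- 2); split.
  have : \forall z \near y, z != 0.
    exact: (@cvgr_neq0 _ _ _ (nbhs y) _ id y cvg_id y0).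
  apply: filterS => z z0; apply: is_derive_eq; first by apply: is_deriveV.
  by rewrite -[_ *: _]/(_ * _) mulr1.
apply: cvgN; apply: cvgV; first by rewrite expf_neq0.
exact: exprn_continuous.
Qed.

Lemma C1at_sqrt y : 0 < y -> C1at Num.sqrt y.
Proof.
move=> y0; exists (fun z => (2 * Num.sqrt z)^-1); split.
  by apply: filterS (lt_nbhsr y0) => z z0; exact: is_derive1_sqrt.
apply: cvgV; first by rewrite mulf_neq0// gt_eqF// sqrtr_gt0.
by apply: cvgMr; exact: sqrt_continuous.
Qed.

Lemma bounded_compact_support f : continuous f ->
  (forall y, y < 0 \/ 1 < y -> f y = 0) -> exists M, forall y, `|f y| <= M.
Proof.
move=> cf f0.
have cnf : {within `[0, 1], continuous (fun y => `|f y|)}.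
  by apply: continuous_subspaceT => y; apply: cvg_norm; exact: cf.
have [k _ hk] := EVT_max (@ler01 R) cnf.
exists `|f k| => y; have [y0|y0] := ltP y 0; first by rewrite f0 ?normr0//; left.
have [y1|y1] := ltP 1 y; first by rewrite f0 ?normr0//; right.
by apply: hk; rewrite in_itv /= y0 y1.
Qed.

End C1At.

Section UnfoldLorentz.
Variables (R : realType) (c N : R) (f : R -> R).
Hypothesis fC1 : C1R f.
Hypothesis f_left : forall t, t < c + 1 -> f t = 0.
Hypothesis f_right : forall t, N < t -> f t = 0.

(* Inverse of [lor c] on the half-line [t >= c], as a distance to [c]. *)
Definition lor_inv (y : R) : R := Num.sqrt (y^-1 - 1).

Lemma lor_invK t : lor_inv (lor c t) = `|t - c|.
Proof. by rewrite /lor_inv /lor invrK addrAC subrr add0r sqrtr_sqr. Qed.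

(** With [tau = 1] this is the [phi] with [phi(lor c t) = f t] for [t >= c]; with [tau] the inverse
    of [lor_inv] it is the [psi] that represents [f t/(t - c)]. *)
Definition profile (tau : R -> R) (y : R) : R := f (lor_inv y + c) * tau y.

(** The value of [lor c] at the right end [N] of the support. *)
Let y1 : R := (1 + (N - c) ^+ 2)^-1.

Lemma profile_near0 tau y : y < y1 -> profile tau y = 0.
Proof.
move=> yy1; rewrite /profile; have [y0|y0] := leP y 0.
  (* For [y <= 0] the square root takes its default value 0, so [f] is evaluated at [c], left of its
     support. *)
  rewrite /lor_inv ler0_sqrtr; first by rewrite add0r f_left ?mul0r// ltrDl.
  by rewrite subr_le0 (@le_trans _ _ 0)// invr_le0.
(* For [0 < y < y1] the distance [lor_inv y] exceeds [|N - c|], so the argument of [f] lies beyond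
   [N]. *)
rewrite f_right ?mul0r// -ltrBlDr.
apply: (le_lt_trans (ler_norm _)); rewrite -sqrtr_sqr /lor_inv ltr_sqrt.
  rewrite ltrBrDl -[ltLHS]invrK ltf_pV2// posrE invr_gt0.
  by rewrite ltr_wpDr// sqr_ge0.
rewrite subr_gt0 invf_gt1//; apply: lt_le_trans yy1 _.
by rewrite invf_le1 ?lerDl ?sqr_ge0// ltr_wpDr// sqr_ge0.
Qed.

(** The threshold is [lor c (c + 1) = 1/2]: above it [lor_inv y < 1], and the argument of [f] stays
    below [c + 1]. *)
Lemma profile_near1 tau y : 2^-1 < y -> profile tau y = 0.
Proof.
move=> hy; have y0 : 0 < y by apply: lt_trans hy; rewrite invr_gt0.
rewrite /profile f_left ?mul0r// addrC ltrD2l /lor_inv.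
rewrite -[ltRHS]sqrtr1 ltr_sqrt// ltrBlDr -[ltRHS]invrK ltf_pV2 ?posrE//.
Qed.

Lemma C1at_lor_inv y : 0 < y < 1 -> C1at lor_inv y.
Proof.
move=> /andP[y0 y1']; apply: (C1at_comp (f := fun z => z^-1 - 1)); last first.
  by apply: C1at_sqrt; rewrite subr_gt0 invf_gt1.
apply: (C1atD (g := fun=> -1)); last exact: C1at_cst.
by apply: C1at_inv; rewrite gt_eqF.
Qed.

(** The vanishing near 0 and near 1 hides the singularities of [lor_inv] and [tau] there; in between
    the profile is a product of C^1 functions. *)
Lemma C1R_profile tau : (forall y, 0 < y < 1 -> C1at tau y) -> C1R (profile tau).
Proof.
move=> ht; apply/C1R_C1at => y.
have [yy1|yy1] := ltP y y1.
  apply: (C1at_near (f := fun=> 0)); last exact: C1at_cst.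
  by apply: filterS (lt_nbhsl yy1) => z zy; rewrite profile_near0.
have [y2|y2] := ltP 2^-1 y.
  apply: (C1at_near (f := fun=> 0)); last exact: C1at_cst.
  by apply: filterS (lt_nbhsr y2) => z zy; rewrite profile_near1.
have y01 : 0 < y < 1.
  apply/andP; split; last by apply: le_lt_trans y2 _; rewrite invf_lt1 ?ltr1n.
  by apply: lt_le_trans yy1; rewrite invr_gt0 ltr_wpDr// sqr_ge0.
apply: C1atM; last exact: ht.
apply: (C1at_comp (f := fun z => lor_inv z + c)); last by move/C1R_C1at: fC1.
by apply: C1atD; [exact: C1at_lor_inv|exact: C1at_cst].
Qed.

Lemma profile_bounded tau : (forall y, 0 < y < 1 -> C1at tau y) ->
  exists M, forall y,
    `|profile tau y| <= M /\ `|(profile tau)^`()%classic y| <= M.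
Proof.
move=> ht; have [dp cdp] := C1R_profile ht.
have y1_gt0 : 0 < y1 by rewrite invr_gt0 ltr_wpDr// sqr_ge0.
have half : (2^-1 : R) < 1 by rewrite invf_lt1 ?ltr1n.
have [||M1 h1] := bounded_compact_support (f := profile tau).
- by move=> y; apply: differentiable_continuous; apply/derivable1_diffP.
- move=> y [y0|y0]; first by rewrite profile_near0// (lt_trans y0).
  by rewrite profile_near1// (lt_trans half).
have [|M2 h2] := bounded_compact_support cdp.
  move=> y hy; rewrite derive1E -[RHS](@derive_cst _ _ _ (0 : R) y (1 : R)).
  apply: near_eq_derive; case: hy => hy.
    by apply: filterS (lt_nbhsl hy) => z zy; rewrite profile_near0// (lt_trans zy).
  by apply: filterS (lt_nbhsr hy) => z zy; rewrite profile_near1// (lt_trans half).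
exists (Num.max M1 M2) => y; split; rewrite le_max; first by rewrite h1.
by rewrite h2 orbT.
Qed.

End UnfoldLorentz.

(** * Compactly supported functions and the final formula *)

Lemma good_C1c (R : realType) (mu : {measure set R -> \bar R}) (a : R)
    (mua : {measure set R -> \bar R}) (V : (R -> R[i]) -> R -> R[i]) (f : R -> R) :
  mu setT != 0%E ->
  (\int[mu]_t ((1 + `|t|)^-1 : R)%:E < +oo)%E ->
  spectral_rep mu a mua V ->
  C1R f -> (exists A B : R, forall t, t < A \/ B < t -> f t = 0) ->
  good mu a mua V f.
Proof.
move=> mu0 mu_fin hV fC1 [A [B fAB]].
(* Puts the support at distance at least 1 to the right of [c]. *)
pose c := A - 1.
have f_left t : t < c + 1 -> f t = 0.
  by rewrite subrK => tA; apply: fAB; left.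
have f_right t : B < t -> f t = 0 by move=> Bt; apply: fAB; right.
pose t1 := fun _ : R => 1 : R; pose t2 y := (@lor_inv R y)^-1.
have C1 y : 0 < y < 1 -> C1at t1 y by move=> _; exact: C1at_cst.
have C2 y : 0 < y < 1 -> C1at t2 y.
  move=> y01; apply: (C1at_comp (C1at_lor_inv y01)).
  apply: C1at_inv; move/andP: y01 => [y0 y1].
  by rewrite gt_eqF// sqrtr_gt0 subr_gt0 invf_gt1.
have p0 tau : profile c f tau 0 = 0.
  by apply: (profile_near0 f_left f_right); rewrite invr_gt0 ltr_wpDr// sqr_ge0.
have good_profile tau : (forall y, 0 < y < 1 -> C1at tau y) ->
    good mu a mua V (lor_comp c (profile c f tau)) /\
    good mu a mua V (shift_lor_comp c (profile c f tau)).
  move=> ht; have [dp cdp] := C1R_profile fC1 f_left f_right ht.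
  have [M hM] := profile_bounded fC1 f_left f_right ht.
  by apply: (good_lor_comp c mu0 mu_fin hV (M := M)) => // y; case: (hM y).
have [g1 _] := good_profile _ C1; have [_ g2] := good_profile _ C2.
have := good_lincomb mu_fin hV 2^-1 g1 (good_scale mu_fin hV 2^-1 g2).
congr good; apply/funext => t.
rewrite /lor_comp /shift_lor_comp /profile /t1 /t2 !lor_invK mulr1.
(* Here [lor_inv] returns [|t - c|]: right of [c] both halves equal [f t / 2], left of [c] they are
   opposite. *)
have [ct|tc] := ltP c t.
  have tc0 : t - c != 0 by rewrite gt_eqF// subr_gt0.
  rewrite gtr0_norm ?subr_gt0// subrK; field.
  exact: tc0.
rewrite ler0_norm ?subr_le0// opprB (f_left t) ?(le_lt_trans tc) ?ltrDl//.
have [->|tc'] := eqVneq t c; first by rewrite subrr add0r f_left ?ltrDl// !mul0r !mulr0 addr0.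
by field; rewrite subr_eq0 eq_sym.
Qed.

Lemma diffquotE (R : realType) (f : R -> R[i]) (s t : R) : diffquot f s t =
  Complex (dq (fun t => Re (f t)) s t) (dq (fun t => Im (f t)) s t).
Proof.
rewrite /diffquot /dq; case: eqP => // _.
rewrite -rmorphB -fmorphV; move: (f s) (f t) => [x y] [x' y'].
by apply/eqP; rewrite eq_complex /= !mulr0 subr0 add0r !eqxx.
Qed.

Unset Implicit Arguments.

Theorem theorem2p1 (R : realType) (mu : {measure set R -> \bar R}) :
  mu setT != 0%E ->
  (\int[mu]_t ((1 + `|t|)^-1 : R)%:E < +oo)%E ->
  forall (a : R) (mua : {measure set R -> \bar R}),
    is_pert_spectral_measure mu a mua ->
  forall V : (R -> R[i]) -> (R -> R[i]), spectral_rep mu a mua V ->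
  forall f : R -> R[i], C1c f ->
    ae_eqC mua (V f) (fun s => f s - a%:C * Cint mu (diffquot f s)).
Proof.
move=> mu0 mu_fin a mua _ V hV f [C1re C1im [A [B fAB]]].
have gre : good mu a mua V (fun t => Re (f t)).
  by apply: good_C1c => //; exists A, B => t /fAB ->.
have gim : good mu a mua V (fun t => Im (f t)).
  by apply: good_C1c => //; exists A, B => t /fAB ->.
have [[M reM] Vre] := gre; have [[N imN] Vim] := gim.
(* Reassembles [f = i Im f + Re f] from its two real parts. *)
have := srep_lin hV (Complex 0 1) (C1bounded_L2 mu_fin imN) (C1bounded_L2 mu_fin reM).
apply: filterS3 Vre Vim => s hre him.
rewrite (_ : (fun t => _ + _) = f); last first.
  apply/funext => t; move: (f t) => [x y].
  by apply/eqP; rewrite eq_complex /=; apply/andP; split; apply/eqP; ring.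
move=> ->; rewrite hre him /Cint /pertT.
have -> : (fun t => Re (diffquot f s t)) = dq (fun t => Re (f t)) s.
  by apply/funext => t; rewrite diffquotE.
have -> : (fun t => Im (diffquot f s t)) = dq (fun t => Im (f t)) s.
  by apply/funext => t; rewrite diffquotE.
move: (f s) => [x y].
by apply/eqP; rewrite eq_complex /=; apply/andP; split; apply/eqP; ring.
Qed.
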